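(* Let $E$ be an elliptic curve over $\mathbb{Q}$, let $f\ge1$ be an integer and let $a$ be an integer with $\gcd(a,f)=1$. Assume that $K_d\subseteq\mathbb{Q}(\zeta_f)$ for some $d\in\{2,3,4,5,6,8\}$ and that $\sigma_a$ fixes $K_d$ pointwise. Then $\widetilde{E}(\mathbb{F}_p)$ is cyclic for at most finitely many primes $p\equiv a\pmod f$.
   Context: For a prime $p$ of good reduction of $E$, $\widetilde{E}(\mathbb{F}_p)$ is the group of $\mathbb{F}_p$-rational points of the reduction of (a global minimal model of) $E$ modulo $p$. $K_d=\mathbb{Q}(E[d])$ is the $d$-division field of $E$. $\zeta_f$ is a primitive $f$-th root of unity, and for $\gcd(a,f)=1$, $\sigma_a\in\mathrm{Gal}(\mathbb{Q}(\zeta_f)/\mathbb{Q})$ is the automorphism with $\sigma_a(\zeta_f)=\zeta_f^a$. Only primes of good reduction are considered (there are finitely many others). *)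

(* Defs.v *)
From HB Require Import structures.
From mathcomp Require Import all_boot all_order all_algebra all_fingroup all_field.
From mathcomp Require Import boolp classical_sets functions cardinality.

Set Implicit Arguments.
Unset Strict Implicit.
Unset Printing Implicit Defensive.

Import Order.TTheory GRing.Theory Num.Theory.

Local Open Scope classical_set_scope.
Local Open Scope ring_scope.

(* The curve y^2 + a1 x y + a3 y = x^3 + a2 x^2 + a4 x + a6. *)
Record weierstrass (R : Type) := Weierstrass
  { a1 : R; a2 : R; a3 : R; a4 : R; a6 : R }.

Definition map_weierstrass (R S : Type) (h : R -> S) (W : weierstrass R) :
  weierstrass S :=
  Weierstrass (h (a1 W)) (h (a2 W)) (h (a3 W)) (h (a4 W)) (h (a6 W)).

Section Discriminant.
Variables (R : comNzRingType) (W : weierstrass R).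

Definition b2 : R := a1 W ^+ 2 + 4 * a2 W.
Definition b4 : R := 2 * a4 W + a1 W * a3 W.
Definition b6 : R := a3 W ^+ 2 + 4 * a6 W.
Definition b8 : R :=
  a1 W ^+ 2 * a6 W + 4 * a2 W * a6 W - a1 W * a3 W * a4 W
  + a2 W * a3 W ^+ 2 - a4 W ^+ 2.
Definition disc : R :=
  - b2 ^+ 2 * b8 - 8 * b4 ^+ 3 - 27 * b6 ^+ 2 + 9 * b2 * b4 * b6.

End Discriminant.

Definition elliptic (R : comNzRingType) (W : weierstrass R) : Prop :=
  disc W != 0.

Section GroupLaw.
Variables (F : fieldType) (W : weierstrass F).

(* [None] is the point at infinity. *)
Definition rational_points : set (option (F * F)) :=
  [set P | if P is Some (x, y)
           then y ^+ 2 + a1 W * x * y + a3 W * y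
                = x ^+ 3 + a2 W * x ^+ 2 + a4 W * x + a6 W
           else True].

Definition oppp (P : option (F * F)) : option (F * F) :=
  if P is Some (x, y) then Some (x, - y - a1 W * x - a3 W) else None.

(* [lam] is the slope of the chord through P and Q, or of the tangent at P
   when P = Q; on the curve, x1 = x2 and Q <> - P force P = Q. *)
Definition addp (P Q : option (F * F)) : option (F * F) :=
  match P, Q with
  | None, _ => Q
  | _, None => P
  | Some (x1, y1), Some (x2, y2) =>
    if Q == oppp P then None else
    let lam :=
      if x1 == x2
      then (3 * x1 ^+ 2 + 2 * a2 W * x1 + a4 W - a1 W * y1)
           / (2 * y1 + a1 W * x1 + a3 W)
      else (y2 - y1) / (x2 - x1) in
    let x3 := lam ^+ 2 + a1 W * lam - a2 W - x1 - x2 in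
    oppp (Some (x3, y1 + lam * (x3 - x1)))
  end.

Definition mulpn (n : nat) (P : option (F * F)) : option (F * F) :=
  iter n (addp P) None.

Definition mulpz (n : int) (P : option (F * F)) : option (F * F) :=
  match n with
  | Posz k => mulpn k P
  | Negz k => oppp (mulpn k.+1 P)
  end.

Definition cyclic_points : Prop :=
  exists2 P, rational_points P &
    forall Q, rational_points Q -> exists n : int, Q = mulpz n P.

Definition torsion_points (d : nat) : set (option (F * F)) :=
  [set P | rational_points P /\ mulpn d P = None].

(* The equation obtained by x = u^2 x' + r, y = u^3 y' + u^2 s x' + t. *)
Definition change_of_variables (u r s t : F) : weierstrass F :=
  Weierstrass
    ((a1 W + 2 * s) / u)
    ((a2 W - s * a1 W + 3 * r - s ^+ 2) / u ^+ 2)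
    ((a3 W + r * a1 W + 2 * t) / u ^+ 3)
    ((a4 W - s * a3 W + 2 * r * a2 W - (t + r * s) * a1 W
      + 3 * r ^+ 2 - 2 * s * t) / u ^+ 4)
    ((a6 W + r * a4 W + r ^+ 2 * a2 W + r ^+ 3 - t * a3 W - t ^+ 2
      - r * t * a1 W) / u ^+ 6).

End GroupLaw.

Definition isomorphic (F : fieldType) (W W' : weierstrass F) : Prop :=
  exists u r s t : F, u != 0 /\ W' = change_of_variables W u r s t.

Definition p_integral (p : nat) (x : rat) : Prop := ~~ (p %| `|denq x|)%N.

Definition p_integral_model (p : nat) (W : weierstrass rat) : Prop :=
  [/\ p_integral p (a1 W), p_integral p (a2 W), p_integral p (a3 W),
      p_integral p (a4 W) & p_integral p (a6 W)].

(* The discriminant of a p-integral equation is p-integral, so its p-adic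
   valuation is that of its numerator. *)
Definition disc_val (p : nat) (W : weierstrass rat) : nat :=
  logn p `|numq (disc W)|.

Definition minimal_at (p : nat) (W : weierstrass rat) : Prop :=
  p_integral_model p W /\
  forall W' : weierstrass rat,
    isomorphic W W' -> p_integral_model p W' ->
    (disc_val p W <= disc_val p W')%N.

Definition global_minimal_model
    (E : weierstrass rat) (W : weierstrass int) : Prop :=
  let WQ := map_weierstrass (fun n : int => n%:~R : rat) W in
  isomorphic E WQ /\ forall p : nat, prime p -> minimal_at p WQ.

(* To be used for a global minimal model [W]. *)
Definition good_reduction (W : weierstrass int) (p : nat) : Prop :=
  ~~ (p%:Z %| disc W)%Z.

Definition reduction (W : weierstrass int) (p : nat) : weierstrass 'F_p :=
  map_weierstrass (fun n : int => n%:~R : 'F_p) W.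

Definition subfield_gen (X : set algC) : set algC :=
  smallest (fun S : set algC => divring_closed [in S]) X.

Definition torsion_coordinates (E : weierstrass rat) (d : nat) : set algC :=
  [set c | exists x y : algC,
     torsion_points (map_weierstrass ratr E) d (Some (x, y))
     /\ (c = x \/ c = y)].

Definition division_field (E : weierstrass rat) (d : nat) : set algC :=
  subfield_gen (torsion_coordinates E d).

(* Main.v *)
(* A prime factor q in {2, 3, 5} of d has K_q inside K_d, so it suffices to
   exhibit q + 1 points of order dividing q over F_p, which a cyclic group does
   not have.  Over the algebraic numbers such points come from enough distinct
   roots of the q-division polynomial.  Their coordinates lie in Q(zeta) and are
   fixed by sigma_a.  For almost all p = a mod f, reduction at a place above p,
   given by a root z of the cyclotomic polynomial in the algebraic closure of
   F_p, respects the finitely many operations involved, and sigma_a reduces to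
   the Frobenius, so that the reduced points have coordinates in F_p.
   Associativity of the chord-tangent law, needed to use that the group of
   points is cyclic, comes from sending a point P to the class of its ideal
   (X - x_P, Y - y_P) in the coordinate ring: a line through P, Q and -(P + Q)
   makes this map additive, and it is injective because no norm from the
   coordinate ring has degree one. *)

(* Since q + 1 points suffice, the full structure of E[q] is never determined. It is enough that the
   cubic and the 3-division polynomial have two roots and the 5-division polynomial three; with
   fewer roots, a polynomial of this shape would force the discriminant to vanish. Reduction is kept
   as a relation. Every x in Q(zeta) satisfies n x = g(zeta) with g integral and n > 0, so it has a
   reduction for all p > n, and any finite computation can be reduced for all large p. The obstacle
   is that [addp] branches on equality tests: a test on x and y survives reduction as soon as the
   inverse of x - y reduces. With the convention 0^-1 = 0 this covers x = y too, so both tests and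
   divisions become integrality of finitely many inverses. *)
Require Import Defs.
From HB Require Import structures.
From mathcomp Require Import all_boot all_order all_algebra all_fingroup all_field.
From mathcomp Require Import boolp classical_sets functions cardinality.
From mathcomp Require Import ring zify.

Set Implicit Arguments.
Unset Strict Implicit.
Unset Printing Implicit Defensive.

Import Order.TTheory GRing.Theory Num.Theory.

Local Open Scope classical_set_scope.
Local Open Scope ring_scope.

(** * The coordinate ring *)

(* The pair (a, b) stands for a + b Y in F[X, Y] modulo the curve. *)
Definition coord_ring (F : fieldType) (W : weierstrass F) : Type :=
  ({poly F} * {poly F})%type.

Section CoordRing.
Variables (F : fieldType) (W : weierstrass F).
Local Notation R := (coord_ring W).

Definition ylin : {poly F} := (a1 W)%:P * 'X + (a3 W)%:P.
Definition cubic : {poly F} :=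
  'X ^+ 3 + (a2 W)%:P * 'X ^+ 2 + (a4 W)%:P * 'X + (a6 W)%:P.

HB.instance Definition _ := GRing.Zmodule.copy R ({poly F} * {poly F})%type.

Definition coord_one : R := (1, 0).
Definition coord_mul (u v : R) : R :=
  (u.1 * v.1 + u.2 * v.2 * cubic, u.1 * v.2 + u.2 * v.1 - u.2 * v.2 * ylin).

Fact coord_mulA : associative coord_mul.
Proof. by move=> u v w; congr pair => /=; ring. Qed.
Fact coord_mulC : commutative coord_mul.
Proof. by move=> u v; congr pair => /=; ring. Qed.
Fact coord_mul1 : left_id coord_one coord_mul.
Proof. by move=> [u1 u2]; congr pair => /=; ring. Qed.
Fact coord_mulDl : left_distributive coord_mul +%R.
Proof. by move=> u v w; congr pair => /=; ring. Qed.
Fact coord_one_neq0 : coord_one != 0.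
Proof. by apply/eqP => -[] /eqP; rewrite oner_eq0. Qed.

HB.instance Definition _ := GRing.Zmodule_isComNzRing.Build R
  coord_mulA coord_mulC coord_mul1 coord_mulDl coord_one_neq0.

Lemma coordM (u v : R) : u * v =
  (u.1 * v.1 + u.2 * v.2 * cubic, u.1 * v.2 + u.2 * v.1 - u.2 * v.2 * ylin).
Proof. by []. Qed.

Definition coordY : R := (0, 1).

(** The product of a + b Y with its conjugate under Y -> - Y - [ylin], the involution P -> -P. *)
Definition normc (u : R) : {poly F} :=
  u.1 ^+ 2 - u.1 * u.2 * ylin - u.2 ^+ 2 * cubic.

Lemma normcM u v : normc (u * v) = normc u * normc v.
Proof. by rewrite coordM /normc /=; ring. Qed.

Lemma size_cubic : size cubic = 4%N.
Proof.
rewrite /cubic -!addrA size_polyDl ?size_polyXn //.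
rewrite (leq_ltn_trans (size_polyD _ _)) // gtn_max.
rewrite (leq_ltn_trans (size_polyMleq _ _)) ?size_polyXn ?size_polyC;
  last by case: (_ != _).
rewrite (leq_ltn_trans (size_polyD _ _)) // gtn_max.
rewrite (leq_ltn_trans (size_polyMleq _ _)) ?size_polyX ?size_polyC;
  last by case: (_ != _).
by case: (_ != _).
Qed.

Lemma size_ylin : (size ylin <= 2)%N.
Proof.
rewrite (leq_trans (size_polyD _ _)) // geq_max.
rewrite (leq_trans (size_polyMleq _ _)) ?size_polyX ?size_polyC;
  last by case: (_ != _).
by case: (_ != _).
Qed.

(* The degrees 2 deg a and 2 deg b + 3 of the extreme terms differ in parity,
   so they cannot cancel. *)
Lemma size_normc (u : R) : u.2 != 0 -> (4 <= size (normc u))%N.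
Proof.
case: u => a b /= b0; rewrite /normc /=.
have sb : (0 < size b)%N by rewrite size_poly_gt0.
have s3 : size (b ^+ 2 * cubic) = (2 * size b + 2)%N.
  have c0 : cubic != 0 by rewrite -size_poly_gt0 size_cubic.
  rewrite size_mul ?expf_neq0 // size_cubic expr2 size_mul //.
  by move: (size b) sb => n; lia.
have s2 : (size (a * b * ylin)%R <= size a + size b)%N.
  rewrite (leq_trans (size_polyMleq _ _)) //.
  have := size_ylin; have := size_polyMleq a b; lia.
have [a0|a0] := eqVneq a 0.
  by rewrite a0 expr0n /= !mul0r subr0 sub0r size_polyN s3; lia.
have sa : (0 < size a)%N by rewrite size_poly_gt0.
have s1 : size (a ^+ 2) = (2 * size a - 1)%N.
  by rewrite expr2 size_mul //; move: (size a) sa => n; lia.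
have [sab|sab] := leqP (size a) (size b).+1.
  rewrite addrC size_polyDl ?size_polyN; first by rewrite s3; lia.
  rewrite (leq_ltn_trans (size_polyD _ _)) // gtn_max size_polyN s1 s3.
  by apply/andP; split; [lia|apply: leq_ltn_trans s2 _; lia].
rewrite -addrA size_polyDl; first by rewrite s1; lia.
rewrite (leq_ltn_trans (size_polyD _ _)) // gtn_max !size_polyN s1 s3.
by apply/andP; split; [apply: leq_ltn_trans s2 _; lia|lia].
Qed.

Lemma normc_eq0 (u : R) : normc u = 0 -> u = 0.
Proof.
move=> nu; have u2 : u.2 = 0.
  by apply/eqP/negPn/negP => /size_normc; rewrite nu size_poly0.
move: nu u2; case: u => a b /= + b0; rewrite /normc b0 /= => /eqP.
by rewrite expr0n /= mulr0 !mul0r !subr0 expf_eq0 /= => /eqP ->.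
Qed.

Lemma coord_mulf_eq0 (u v : R) : u * v = 0 -> u = 0 \/ v = 0.
Proof.
move/(congr1 normc); rewrite normcM.
have -> : normc 0 = 0 by rewrite /normc /=; ring.
by move/eqP; rewrite mulf_eq0 => /orP[] /eqP /normc_eq0; [left|right].
Qed.

Lemma coord_mulfI (u : R) : u != 0 -> injective ( *%R u).
Proof.
move=> u0 v w /eqP; rewrite -subr_eq0 -mulrBr => /eqP /coord_mulf_eq0[u0'|/eqP].
  by rewrite u0' eqxx in u0.
by rewrite subr_eq0 => /eqP.
Qed.

Lemma coord_mulf_neq0 (u v : R) : u != 0 -> v != 0 -> u * v != 0.
Proof.
by move=> u0 v0; apply/eqP => /coord_mulf_eq0[] /eqP; apply/negP.
Qed.

End CoordRing.

(** * The group law *)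

Section Ideals.
Variables (F : fieldType) (W : weierstrass F).
Local Notation R := (coord_ring W).

Definition coordX : R := ('X, 0).
Local Notation X := coordX.
Local Notation Y := (coordY W).

Definition cst (c : F) : R := (c%:P, 0).

Fact cst_is_zmod : zmod_morphism cst.
Proof. by move=> c e; congr pair; rewrite /= ?subr0 // polyCB. Qed.
Fact cst_is_monoid : monoid_morphism cst.
Proof.
by split => // c e; rewrite coordM; congr pair; rewrite /= ?polyCM; ring.
Qed.
HB.instance Definition _ := GRing.isZmodMorphism.Build F R cst cst_is_zmod.
HB.instance Definition _ := GRing.isMonoidMorphism.Build F R cst cst_is_monoid.

Definition on_curve (x y : F) :=
  y ^+ 2 + a1 W * x * y + a3 W * y
    = x ^+ 3 + a2 W * x ^+ 2 + a4 W * x + a6 W.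

Lemma coord_eq : Y ^+ 2 = X ^+ 3 + cst (a2 W) * X ^+ 2 + cst (a4 W) * X
  + cst (a6 W) - (cst (a1 W) * X + cst (a3 W)) * Y.
Proof.
rewrite !exprS expr0 mulr1 !coordM /cubic /ylin; congr pair => /=; ring.
Qed.

Definition ideal (J : set R) :=
  [/\ J 0, forall u v, J u -> J v -> J (u + v) & forall r u, J u -> J (r * u)].

Lemma idealT : ideal setT. Proof. by []. Qed.

Lemma ideal_cst (J : set R) c : ideal J -> c != 0 -> J (cst c) -> J 1.
Proof.
case=> _ _ JM c0 Jc; have -> : (1 : R) = cst c^-1 * cst c.
  by rewrite -rmorphM mulVf // rmorph1.
exact: JM.
Qed.

(* [ptmul P J] is the product of J with the ideal of the point P. *)
Definition ptmul (P : option (F * F)) (J : set R) : set R :=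
  if P is Some (x, y) then
    [set u | exists v w,
       [/\ J v, J w & u = (X - cst x) * v + (Y - cst y) * w]]
  else J.

Lemma ptmul_ideal P J : ideal J -> ideal (ptmul P J).
Proof.
case: P => [[x y]|//] [J0 JD JM]; split.
- by exists 0, 0; split => //; ring.
- move=> _ _ [v [w [Jv Jw ->]]] [v' [w' [Jv' Jw' ->]]].
  by exists (v + v'), (w + w'); split; [exact: JD | exact: JD | ring].
- move=> r _ [v [w [Jv Jw ->]]].
  by exists (r * v), (r * w); split; [exact: JM | exact: JM | ring].
Qed.

Lemma ptmulC P Q J : ptmul P (ptmul Q J) = ptmul Q (ptmul P J).
Proof.
wlog suff H : P Q / ptmul P (ptmul Q J) `<=` ptmul Q (ptmul P J).
  by apply/seteqP; split; apply: H.
case: P => [[x y]|//]; case: Q => [[x' y']|//].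
move=> _ [_ [_ [[a [b [Ja Jb ->]]] [c [d [Jc Jd ->]]] ->]]].
exists ((X - cst x) * a + (Y - cst y) * c), ((X - cst x) * b + (Y - cst y) * d).
by split; [exists a, c | exists b, d | ring].
Qed.

Definition scale (f : R) (J : set R) : set R := [set f * u | u in J].

Lemma ptmul_scale P f J : ptmul P (scale f J) = scale f (ptmul P J).
Proof.
case: P => [[x y]|//]; apply/seteqP; split.
  move=> _ [_ [_ [[v Jv <-] [w Jw <-] ->]]].
  by exists ((X - cst x) * v + (Y - cst y) * w); [exists v, w | ring].
move=> _ [_ [v [w [Jv Jw ->]]] <-]; exists (f * v), (f * w).
by split; [exists v | exists w | ring].
Qed.

Lemma scaleM f g J : scale (f * g) J = scale f (scale g J).
Proof.
apply/seteqP; split.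
  by move=> _ [u Ju <-]; exists (g * u); [exists u | ring].
by move=> _ [_ [u Ju <-] <-]; exists u => //; ring.
Qed.

Lemma scale1 J : scale 1 J = J.
Proof.
apply/seteqP; split; first by move=> _ [u Ju <-]; rewrite mul1r.
by move=> u Ju; exists u => //; rewrite mul1r.
Qed.

(** Equality of ideal classes, I = (g/f) J, with denominators cleared so that fractional ideals are
    avoided. *)
Definition sim (I J : set R) :=
  exists f g, [/\ f != 0, g != 0 & scale f I = scale g J].

Lemma sim_refl J : sim J J.
Proof. by exists 1, 1; split; rewrite ?oner_eq0. Qed.

Lemma sim_sym I J : sim I J -> sim J I.
Proof. by move=> [f [g [f0 g0 E]]]; exists g, f. Qed.

Lemma sim_trans J I K : sim I J -> sim J K -> sim I K.
Proof.
move=> [f [g [f0 g0 E]]] [f' [g' [f'0 g'0 E']]]; exists (f' * f), (g * g').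
split; rewrite ?coord_mulf_neq0 // scaleM E -scaleM mulrC.
by rewrite (scaleM g f') E' -scaleM.
Qed.

Lemma sim_scale f J : f != 0 -> sim (scale f J) J.
Proof. by move=> f0; exists 1, f; rewrite oner_eq0 scale1. Qed.

Lemma sim_ptmul P I J : sim I J -> sim (ptmul P I) (ptmul P J).
Proof.
by move=> [f [g [f0 g0 E]]]; exists f, g; split; rewrite // -!ptmul_scale E.
Qed.

Definition nonsingular := forall x y, on_curve x y ->
  2 * y + a1 W * x + a3 W != 0 \/
  3 * x ^+ 2 + 2 * a2 W * x + a4 W - a1 W * y != 0.

(** At a singular point the two partial derivatives and the curve equation can be solved for [a3],
    [a4] and [a6]; after substitution the discriminant is identically zero. *)
Lemma elliptic_nonsingular : elliptic W -> nonsingular.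
Proof.
move=> hW x y C; have [E3|] := eqVneq (2 * y + a1 W * x + a3 W) 0; last by left.
right; apply: contra hW => /eqP E4; apply/eqP.
have E3' : a3 W = - (2 * y + a1 W * x) by apply/eqP; rewrite -addr_eq0 addrC E3.
have E4' : a4 W = a1 W * y - 3 * x ^+ 2 - 2 * a2 W * x.
  by apply/eqP; rewrite -subr_eq0 -E4; apply/eqP; ring.
have E6' : a6 W = y ^+ 2 + a1 W * x * y + a3 W * y
                - (x ^+ 3 + a2 W * x ^+ 2 + a4 W * x) by rewrite C; ring.
rewrite /disc /b8 /b6 /b4 /b2 E6' E4' E3'; ring.
Qed.

Hypothesis ns : nonsingular.

(** A colon ideal: membership of f v in I is proved below by producing a nonzero constant here. *)
Lemma ideal_quot I f v : ideal I -> ideal [set w | I (f * w * v)].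
Proof.
case=> I0 ID IM; split => /=.
- by rewrite mulr0 mul0r.
- by move=> u w Iu Iw; rewrite mulrDr mulrDl; apply: ID.
- by move=> r u Iu; rewrite mulrCA -mulrA; apply: IM.
Qed.

(** On the vertical line, (Y - y)(Y - y') = (X - x) q. Hence all four products of generators are
    multiples of X - x, with cofactors X - x, Y - y, Y - y' and q, and nonsingularity makes these
    cofactors generate the unit ideal. *)
Lemma ptmul_opp x y J : on_curve x y -> ideal J ->
  ptmul (Some (x, y)) (ptmul (oppp W (Some (x, y))) J) = scale (X - cst x) J.
Proof.
move=> C idJ; have [J0 JD JM] := idJ.
set y' := - y - a1 W * x - a3 W.
pose q := X ^+ 2 + cst x * X + cst x ^+ 2 + cst (a2 W) * (X + cst x) +
  cst (a4 W) - cst (a1 W) * Y.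
have HY : (Y - cst y) * (Y - cst y') = (X - cst x) * q.
  have E6' : a6 W = y ^+ 2 + a1 W * x * y + a3 W * y
                - (x ^+ 3 + a2 W * x ^+ 2 + a4 W * x) by rewrite C; ring.
  have := coord_eq; rewrite E6' => H.
  have -> : (Y - cst y) * (Y - cst y') = Y ^+ 2 + (cst (a1 W) * cst x +
    cst (a3 W)) * Y + cst y * cst y' by rewrite /y'; ring.
  by rewrite H /y' /q; ring.
have idI := ptmul_ideal (Some (x, y)) (ptmul_ideal (oppp W (Some (x, y))) idJ).
apply/seteqP; split.
  move=> _ [_ [_ [[a [b [Ja Jb ->]]] [c [d [Jc Jd ->]]] ->]]].
  rewrite -/y'.
  exists ((X - cst x) * a + (Y - cst y') * b + (Y - cst y) * c + q * d).
    by do !apply: (JD) => //; apply: JM.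
  rewrite (mulrDr (X - cst x)) (mulrA (X - cst x) q) -HY; ring.
move=> _ [v Jv <-].
set I := ptmul _ _ in idI *.
have idK := ideal_quot (X - cst x) v idI.
suff : [set w | I ((X - cst x) * w * v)] 1 by rewrite /= mulr1.
set K := [set _ | _] in idK *; have [K0 KD KM] := idK.
have K1 : K (X - cst x).
  exists ((X - cst x) * v), 0; split; last by ring.
    by exists v, 0; split => //; ring.
  by exists 0, 0; split => //; ring.
have K2 : K (Y - cst y).
  exists 0, ((X - cst x) * v); split; last by ring.
    by exists 0, 0; split => //; ring.
  by exists v, 0; split => //; ring.
have K3 : K (Y - cst y').
  exists ((Y - cst y') * v), 0; split; last by ring.
    by exists 0, v; split => //; rewrite /y'; ring.
  by exists 0, 0; split => //; ring.
have K4 : K q.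
  rewrite /K /= -HY; exists 0, ((Y - cst y') * v); split; last by ring.
    by exists 0, 0; split => //; ring.
  by exists 0, v; split => //; rewrite /y'; ring.
(* Modulo X - x and Y - y, the cofactors Y - y' and q reduce to the two partial derivatives up to
   sign. *)
case: (ns C) => nz; apply: ideal_cst nz _ => //.
  have -> : cst (2 * y + a1 W * x + a3 W) =
     (Y - cst y') + (-1) * (Y - cst y) by rewrite /y'; ring.
  by apply: KD => //; apply: KM.
have -> : cst (3 * x ^+ 2 + 2 * a2 W * x + a4 W - a1 W * y) =
   q +
   (cst (a1 W) * (Y - cst y) + (- (X + 2 * cst x + cst (a2 W))) * (X - cst x)).
  by rewrite /q; ring.
by apply: (KD) => //; apply: (KD); apply: KM.
Qed.

(* The last equation for [lam] is the curve equation along the line, as a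
   difference quotient between x1 and x2; it covers the tangent case x1 = x2. *)
Lemma line_product x1 y1 x2 y2 lam J :
  let x3 := lam ^+ 2 + a1 W * lam - a2 W - x1 - x2 in
  let y3 := y1 + lam * (x3 - x1) in
  on_curve x1 y1 -> on_curve x2 y2 -> y2 = y1 + lam * (x2 - x1) ->
  (x1 = x2 -> 2 * y1 + a1 W * x1 + a3 W != 0) ->
  lam * (y1 + y2) + a1 W * (y1 + lam * x2) + a3 W * lam
     = x1 ^+ 2 + x1 * x2 + x2 ^+ 2 + a2 W * (x1 + x2) + a4 W ->
  ideal J ->
  on_curve x3 y3 /\ ptmul (Some (x1, y1))
    (ptmul (Some (x2, y2)) (ptmul (Some (x3, y3)) J)) =
  scale (Y - (cst lam * (X - cst x1) + cst y1)) J.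
Proof.
move=> x3 y3 C1 C2 Ey2 nz S idJ.
have E4 : a4 W = lam * (y1 + y2) + a1 W * (y1 + lam * x2) + a3 W * lam
   - (x1 ^+ 2 + x1 * x2 + x2 ^+ 2 + a2 W * (x1 + x2)) by rewrite S; ring.
have E6 : a6 W = y1 ^+ 2 + a1 W * x1 * y1 + a3 W * y1
                - (x1 ^+ 3 + a2 W * x1 ^+ 2 + a4 W * x1) by rewrite C1; ring.
have C3 : on_curve x3 y3 by rewrite /on_curve E6 E4 Ey2 /y3 /x3; ring.
split => //.
set l := Y - (cst lam * (X - cst x1) + cst y1).
(* [m] is minus the conjugate of [l], so l m is minus the norm of [l]: the monic cubic in X whose
   roots are the abscissas of the intersection points. *)
pose m := Y + (cst lam * (X - cst x1) + cst y1) + cst (a1 W) * X + cst (a3 W).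
have HL : (X - cst x1) * (X - cst x2) * (X - cst x3) = l * m.
  have -> : l * m = Y ^+ 2 + (cst (a1 W) * X + cst (a3 W)) * Y -
     (cst lam * (X - cst x1) + cst y1) * (cst lam * (X - cst x1) + cst y1 +
      cst (a1 W) * X + cst (a3 W)) by rewrite /l /m; ring.
  rewrite coord_eq E6 E4 Ey2 /x3; ring.
(* At a point of the line, the generator Y - y can be exchanged for [l]. *)
have ptmulE x y (I : set R) : ideal I -> y = y1 + lam * (x - x1) ->
    ptmul (Some (x, y)) I =
    [set u | exists v w, [/\ I v, I w & u = (X - cst x) * v + l * w]].
  move=> [I0 ID IM] Ey; apply/seteqP; split => u [v [w [Iv Iw ->]]].
    exists (v + cst lam * w), w; split => //; last by rewrite /l Ey; ring.
    by apply: ID => //; apply: IM.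
  exists (v - cst lam * w), w; split => //; last by rewrite /l Ey; ring.
  by apply: ID => //; rewrite -mulNr; apply: IM.
have id3 := ptmul_ideal (Some (x3, y3)) idJ.
have id2 := ptmul_ideal (Some (x2, y2)) id3.
have id1 := ptmul_ideal (Some (x1, y1)) id2.
have [J0 JD JM] := idJ.
rewrite ptmulE // in id1 *; last by ring.
rewrite (ptmulE x2) // (ptmulE x3) // in id1 *.
set I := [set _ | _] in id1 *.
apply/seteqP; split.
  move=> _ [_ [_ [[_ [_ [[a [b [Ja Jb ->]]] [c [d [Jc Jd ->]]] ->]]]
                  [_ [_ [[a' [b' [Ja' Jb' ->]]] [c' [d' [Jc' Jd' ->]]] ->]]] ->]]].
  exists (m * a + (X - cst x1) * (X - cst x2) * b +
    (X - cst x1) * ((X - cst x3) * c + l * d) +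
    ((X - cst x2) * ((X - cst x3) * a' + l * b') +
     l * ((X - cst x3) * c' + l * d'))).
    by repeat match goal with
      | |- J (_ + _) => apply: (JD) | |- J (_ * _) => apply: (JM) end.
  by rewrite !(mulrDr l) (mulrA l m) -HL; ring.
move=> _ [v Jv <-].
have idK := ideal_quot l v id1.
suff : [set w | I (l * w * v)] 1 by rewrite /= mulr1.
set K := [set _ | _] in idK *; have [K0 KD KM] := idK.
(* The triple product has eight generators, each a multiple of [l]. Putting v in one slot and 0 in
   the others shows that the corresponding cofactor lies in K. *)
have memK w a b c d a' b' c' d' : J a -> J b -> J c -> J d -> J a' -> J b' ->
    J c' -> J d' -> l * w * v =
      (X - cst x1) * ((X - cst x2) * ((X - cst x3) * a + l * b) +
                       l * ((X - cst x3) * c + l * d)) +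
       l * ((X - cst x2) * ((X - cst x3) * a' + l * b') +
                       l * ((X - cst x3) * c' + l * d')) -> K w.
  move=> *; eexists; eexists; split; last by eassumption.
    eexists; eexists; split; last by reflexivity.
      by eexists; eexists; split; last by reflexivity.
    by eexists; eexists; split; last by reflexivity.
  eexists; eexists; split; last by reflexivity.
    by eexists; eexists; split; last by reflexivity.
  by eexists; eexists; split; last by reflexivity.
have Km : K m by apply: (memK _ v 0 0 0 0 0 0 0) => //; rewrite -HL; ring.
have K12 : K ((X - cst x1) * (X - cst x2)).
  by apply: (memK _ 0 v 0 0 0 0 0 0) => //; ring.
have K13 : K ((X - cst x1) * (X - cst x3)).
  by apply: (memK _ 0 0 v 0 0 0 0 0) => //; ring.
have K1l : K ((X - cst x1) * l) by apply: (memK _ 0 0 0 v 0 0 0 0) => //; ring.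
have K23 : K ((X - cst x2) * (X - cst x3)).
  by apply: (memK _ 0 0 0 0 v 0 0 0) => //; ring.
have K2l : K ((X - cst x2) * l) by apply: (memK _ 0 0 0 0 0 v 0 0) => //; ring.
have K3l : K ((X - cst x3) * l) by apply: (memK _ 0 0 0 0 0 0 v 0) => //; ring.
have Kll : K (l * l) by apply: (memK _ 0 0 0 0 0 0 0 v) => //; ring.
(* Tangent case: m = c + e with e in (l, X - x1), and c^2 = (c - e) m + e^2, where e^2 is a
   combination of cofactors because x1 = x2. *)
have [E12|N12] := eqVneq x1 x2.
  have c0 := nz E12; set c := 2 * y1 + _ + _ in c0.
  apply: (ideal_cst idK (mulf_neq0 c0 c0)); rewrite rmorphM.
  have Ec : m = cst c + (l + cst (2 * lam + a1 W) * (X - cst x1)).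
    by rewrite /m /l /c; ring.
  have -> : cst c * cst c = (cst c - (l + cst (2 * lam + a1 W) * (X - cst x1))) * m +
    (1 * (l * l) + ((2 * cst (2 * lam + a1 W)) * ((X - cst x1) * l) +
    cst (2 * lam + a1 W) ^+ 2 * ((X - cst x1) * (X - cst x2)))).
    by rewrite Ec -E12; ring.
  by repeat match goal with | _ => assumption
      | |- K (_ + _) => apply: (KD) | |- K (_ * _) => apply: (KM) end.
have d0 : x2 - x1 != 0 by rewrite subr_eq0 eq_sym.
have Kd u : K ((X - cst x1) * u) -> K ((X - cst x2) * u) -> K u.
  move=> k1 k2; have -> : u = cst (x2 - x1)^-1 * ((X - cst x1) * u + (-1) *
     ((X - cst x2) * u)).
    rewrite -[LHS]mul1r -[1 in LHS](rmorph1 cst) -[1 in LHS](mulVf d0) rmorphM.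
    by move: (x2 - x1)^-1 => i; ring.
  by apply: (KM); apply: (KD) => //; apply: (KM).
have Kl := Kd _ K1l K2l.
have K3 := Kd _ K13 K23.
(* If the third point repeats one of the others, the line is tangent there. [m] then gives the
   y-derivative in K, and the x-derivative is [lam] times it, so nonsingularity yields a unit. *)
have sing x y : on_curve x y -> y = y1 + lam * (x - x1) -> x3 = x ->
    (x - x1) * (x - x2) = 0 -> K 1.
  move=> C Ey E3 E0.
  have Kc : K (cst (2 * y + a1 W * x + a3 W)).
    have -> : cst (2 * y + a1 W * x + a3 W) =
      m + ((-1) * l + (- cst (2 * lam + a1 W)) * (X - cst x3)).
      by rewrite /m /l Ey E3; ring.
    by repeat match goal with | _ => assumption
      | |- K (_ + _) => apply: (KD) | |- K (_ * _) => apply: (KM) end.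
  case: (ns C) => nzc; apply: (ideal_cst idK nzc) => //.
  have -> : 3 * x ^+ 2 + 2 * a2 W * x + a4 W - a1 W * y =
     lam * (2 * y + a1 W * x + a3 W).
    (* The difference of the two sides is the derivative at x of (X - x1)(X - x2)(X - x3). The zero
       on the right is rewritten as (x - x1)(x - x2) + (x - x3)(2 x - x1 - x2), which is that
       derivative, so that [ring] can conclude. *)
    apply/eqP; rewrite -subr_eq0 -[X in _ == X](addr0 0) -[X in _ == X + _]E0.
    rewrite -[X in _ == _ + X](mul0r (2 * x - x1 - x2)).
    rewrite -[X in _ == _ + X * _](subrr x).
    rewrite -[X in _ == _ + (_ - X) * _]E3; apply/eqP.
    by rewrite E4 Ey2 Ey /x3; ring.
  by rewrite (rmorphM cst); apply: (KM).
have [E31|N31] := eqVneq x3 x1; first by apply: sing C1 _ E31 _; ring.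
have [E32|N32] := eqVneq x3 x2; first by apply: sing C2 Ey2 E32 _; ring.
have nz3 : (x3 - x1) * (x3 - x2) != 0 by rewrite mulf_neq0 // subr_eq0.
apply: (ideal_cst idK nz3).
have -> : cst ((x3 - x1) * (x3 - x2)) = 1 * ((X - cst x1) * (X - cst x2)) +
   (- (X + cst x3 - cst x1 - cst x2)) * (X - cst x3) by ring.
by apply: (KD); apply: (KM).
Qed.

Lemma opppK P : oppp W (oppp W P) = P.
Proof. by case: P => [[x y]|//] /=; congr (Some (_, _)); ring. Qed.

Lemma oppp_rational P : rational_points W P -> rational_points W (oppp W P).
Proof.
case: P => [[x y]|//] /= C.
transitivity (y ^+ 2 + a1 W * x * y + a3 W * y); last by [].
ring.
Qed.

Lemma coordX_sub_neq0 x : X - cst x != 0.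
Proof. by apply/eqP => -[] /eqP; rewrite polyXsubC_eq0. Qed.

Lemma line_neq0 lam x y : Y - (cst lam * (X - cst x) + cst y) != 0.
Proof.
apply/eqP => /(congr1 snd); rewrite coordM /= => /eqP.
by rewrite !(mulr0, mul0r, subr0, addr0, oner_eq0).
Qed.

Lemma same_abscissa x y1 y2 : on_curve x y1 -> on_curve x y2 ->
    Some (x, y2) != oppp W (Some (x, y1)) ->
  y2 = y1 /\ 2 * y1 + a1 W * x + a3 W != 0.
Proof.
move=> C1 C2 N.
have Ey : y2 = y1.
  have : (y2 - y1) * (y2 - (- y1 - a1 W * x - a3 W)) = 0.
    have -> : (y2 - y1) * (y2 - (- y1 - a1 W * x - a3 W)) =
      (y2 ^+ 2 + a1 W * x * y2 + a3 W * y2) -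
      (y1 ^+ 2 + a1 W * x * y1 + a3 W * y1) by ring.
    by rewrite C1 C2 subrr.
  move/eqP; rewrite mulf_eq0 !subr_eq0 => /orP[/eqP //|/eqP Ey].
  by case/eqP: N; rewrite /= Ey.
split => //; apply: contra N => /eqP Z; apply/eqP; rewrite /= Ey.
congr (Some (_, _)).
by apply/eqP; rewrite -subr_eq0 -Z; apply/eqP; ring.
Qed.

Lemma addpP x1 y1 x2 y2 : on_curve x1 y1 -> on_curve x2 y2 ->
    Some (x2, y2) <> oppp W (Some (x1, y1)) ->
  exists lam,
    let x3 := lam ^+ 2 + a1 W * lam - a2 W - x1 - x2 in
    let y3 := y1 + lam * (x3 - x1) in
    [/\ addp W (Some (x1, y1)) (Some (x2, y2)) = oppp W (Some (x3, y3)),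
        on_curve x3 y3 &
        forall J, ideal J -> ptmul (Some (x1, y1))
          (ptmul (Some (x2, y2)) (ptmul (Some (x3, y3)) J)) =
          scale (Y - (cst lam * (X - cst x1) + cst y1)) J].
Proof.
move=> C1 C2 /eqP N; rewrite /addp (negPf N).
set lam := (if x1 == x2 then _ else _); exists lam.
suff [E2 nz S] : [/\ y2 = y1 + lam * (x2 - x1),
    x1 = x2 -> 2 * y1 + a1 W * x1 + a3 W != 0 &
    lam * (y1 + y2) + a1 W * (y1 + lam * x2) + a3 W * lam
     = x1 ^+ 2 + x1 * x2 + x2 ^+ 2 + a2 W * (x1 + x2) + a4 W].
  have H J : ideal J -> _ := line_product C1 C2 E2 nz S.
  split=> //; first by have [] := H _ idealT.
  by move=> J /H[].
rewrite /lam; case: eqVneq => [E|D].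
  rewrite -E in C2 N; have [Ey nz] := same_abscissa C1 C2 N.
  split => //; first by rewrite -E Ey subrr mulr0 addr0.
  by rewrite Ey -E; field.
have d0 : x2 - x1 != 0 by rewrite subr_eq0 eq_sym.
split; first by field.
  by move=> E; rewrite E eqxx in D.
apply: (mulfI d0).
have -> : (x2 - x1) * ((y2 - y1) / (x2 - x1) * (y1 + y2) +
   a1 W * (y1 + (y2 - y1) / (x2 - x1) * x2) + a3 W * ((y2 - y1) / (x2 - x1))) =
   (y2 ^+ 2 + a1 W * x2 * y2 + a3 W * y2) -
        (y1 ^+ 2 + a1 W * x1 * y1 + a3 W * y1) by field.
by rewrite C1 C2; ring.
Qed.

Lemma addp_rational P Q : rational_points W P -> rational_points W Q ->
  rational_points W (addp W P Q).
Proof.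
case: P => [[x1 y1]|//]; case: Q => [[x2 y2]|//] C1 C2.
have [E|/eqP N] := eqVneq (Some (x2, y2)) (oppp W (Some (x1, y1))).
  by rewrite /addp E eqxx.
have [lam [-> C3 _]] := addpP C1 C2 N.
exact: oppp_rational.
Qed.

Lemma sim_addp P Q J : rational_points W P -> rational_points W Q -> ideal J ->
  sim (ptmul P (ptmul Q J)) (ptmul (addp W P Q) J).
Proof.
case: P => [[x1 y1]|]; last by move=> *; exact: sim_refl.
case: Q => [[x2 y2]|] C1 C2 idJ; last exact: sim_refl.
have [E|/eqP N] := eqVneq (Some (x2, y2)) (oppp W (Some (x1, y1))).
  by rewrite /addp E eqxx ptmul_opp //; apply: sim_scale; exact: coordX_sub_neq0.
have [lam [-> C3 H]] := addpP C1 C2 N.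
set x3 := _ - x2 in C3 H *; set y3 := y1 + _ in C3 H *.
(* With R the third intersection point, multiplying by X - x3 inserts the ideals of R and -R; those
   of P, Q and R then collapse to the line, leaving that of -R = P + Q. *)
exists (X - cst x3), (Y - (cst lam * (X - cst x1) + cst y1)).
split; rewrite ?coordX_sub_neq0 ?line_neq0 // -2!ptmul_scale -(ptmul_opp C3) //.
by rewrite H //; exact: ptmul_ideal.
Qed.

Definition coord_eval (x y : F) (u : R) : F := u.1.[x] + u.2.[x] * y.

Lemma coord_evalM x y u v : on_curve x y ->
  coord_eval x y (u * v) = coord_eval x y u * coord_eval x y v.
Proof.
move=> C.
have : (cubic W).[x] = y ^+ 2 + (ylin W).[x] * y.
  rewrite /cubic /ylin !(hornerD, hornerCM, hornerXn, hornerX, hornerC).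
  transitivity (x ^+ 3 + a2 W * x ^+ 2 + a4 W * x + a6 W); first by ring.
  by rewrite -C; ring.
rewrite /coord_eval coordM /=; move: (cubic W) (ylin W) => c l Ec.
by rewrite !(hornerD, hornerN, hornerM) Ec; ring.
Qed.

(** A generator h of the ideal of P divides X - x, so its norm divides (X - x)^2 and h has no
    Y-part. Dividing Y - y as well, h is then a unit, although it vanishes at P. *)
Lemma sim_ptmul_setT P : rational_points W P -> sim (ptmul P setT) setT -> P = None.
Proof.
case: P => [[x y]|//] C [f [g [f0 g0 E]]]; exfalso.
have [h [Ph Eh]] : exists h, ptmul (Some (x, y)) setT h /\ g = f * h.
  have : scale g setT g by exists 1; rewrite ?mulr1.
  by rewrite -E => -[h Ph <-]; exists h.
have gen u : ptmul (Some (x, y)) setT u -> exists v, u = h * v.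
  move=> Pu; have : scale f (ptmul (Some (x, y)) setT) (f * u) by exists u.
  rewrite E => -[v _]; rewrite Eh -mulrA => /(coord_mulfI f0) <-.
  by exists v.
have [k Ek] : exists k, X - cst x = h * k.
  by apply: gen; exists 1, 0; split => //; ring.
have [k' Ek'] : exists k', Y - cst y = h * k'.
  by apply: gen; exists 0, 1; split => //; ring.
have nX : normc (X - cst x) = ('X - x%:P) ^+ 2.
  by rewrite /normc /=; ring.
have nhk := congr1 (@normc F W) Ek; rewrite normcM nX in nhk.
have h2 : h.2 = 0.
  apply/eqP/negPn/negP => /size_normc.
  have X0 : ('X - x%:P) ^+ 2 != 0 by rewrite expf_neq0 // polyXsubC_eq0.
  have := X0; rewrite nhk mulf_eq0 negb_or => /andP[nh0 nk0].
  have := congr1 (fun p : {poly F} => size p) nhk.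
  rewrite size_exp_XsubC size_mul //; move: nk0; rewrite -size_poly_gt0.
  move=> s1 s2 s3; move: s1 s2 s3; move: (size _) (size _) => n m; lia.
have := congr1 snd Ek'; rewrite coordM h2 /= !(mul0r, subr0, addr0) => h1.
have [r E1] : exists r : R, h * r = 1.
  exists (k'.2, 0); rewrite coordM h2 /= !(mul0r, mulr0, subr0, addr0).
  by rewrite -h1.
have [v [w [_ _ E0]]] := Ph.
have e0 : coord_eval x y h = 0.
  have eD u u' : coord_eval x y (u + u') = coord_eval x y u + coord_eval x y u'.
    by rewrite /coord_eval !hornerD; ring.
  rewrite E0 eD !coord_evalM // /coord_eval /= !hornerE; ring.
have := congr1 (coord_eval x y) E1; rewrite coord_evalM // e0 mul0r.
rewrite /coord_eval /= !hornerE => /eqP; rewrite eq_sym.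
by rewrite ?mul0r ?addr0 oner_eq0.
Qed.

(** If P and Q have the same class, then Q + (-P) has the class of P + (-P), which is trivial. *)
Lemma sim_ptmul_inj P Q : rational_points W P -> rational_points W Q ->
  sim (ptmul P setT) (ptmul Q setT) -> P = Q.
Proof.
move=> CP CQ S.
have idT := idealT.
have CQ' := oppp_rational CQ.
have : addp W Q (oppp W P) = None.
  apply: sim_ptmul_setT; first by apply: addp_rational => //; exact: oppp_rational.
  apply: sim_trans (sim_sym (sim_addp CQ (oppp_rational CP) idT)) _.
  rewrite ptmulC; apply: sim_trans (sim_ptmul _ (sim_sym S)) _.
  rewrite ptmulC; case: P CP S => [[x y]|] CP _; last exact: sim_refl.
  by rewrite ptmul_opp //; apply: sim_scale; exact: coordX_sub_neq0.
case: P CP S => [[x y]|] CP _; case: Q CQ CQ' => [[x' y']|] CQ CQ' //.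
rewrite /addp; case: eqVneq => [+ _|//] => E.
by apply: (can_inj opppK).
Qed.

Lemma addpC P Q : rational_points W P -> rational_points W Q ->
  addp W P Q = addp W Q P.
Proof.
move=> CP CQ; apply: sim_ptmul_inj; try exact: addp_rational.
apply: sim_trans (sim_sym (sim_addp CP CQ idealT)) _.
by rewrite ptmulC; apply: sim_addp.
Qed.

Lemma addpA P Q S :
  rational_points W P -> rational_points W Q -> rational_points W S ->
  addp W P (addp W Q S) = addp W (addp W P Q) S.
Proof.
move=> CP CQ CS; have [CPQ CQS] := (addp_rational CP CQ, addp_rational CQ CS).
apply: sim_ptmul_inj; try exact: addp_rational.
apply: sim_trans (sim_sym (sim_addp CP CQS idealT)) _.
apply: sim_trans (sim_addp CPQ CS idealT).
apply: sim_trans (sim_addp CP CQ (ptmul_ideal S idealT)).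
by apply: sim_ptmul; apply: sim_sym; apply: sim_addp.
Qed.

Lemma addpN P : addp W P (oppp W P) = None.
Proof. by case: P => [[x y]|] //=; rewrite eqxx. Qed.

End Ideals.

(* [ssrint] also defines [mulpz]. *)
Local Notation mulpz := Defs.mulpz.

(** * Torsion in cyclic point groups *)

(** [hW] is a parameter of the type so that the group instance can recover nonsingularity from
    it. *)
Definition ec_point (F : fieldType) (W : weierstrass F) (hW : elliptic W) :=
  {P : option (F * F) | `[< rational_points W P >]}.

Section PointGroup.
Variables (F : fieldType) (W : weierstrass F) (hW : elliptic W).
Local Notation G := (ec_point hW).
Local Notation ns := (elliptic_nonsingular hW).

HB.instance Definition _ := Choice.copy G
  {P : option (F * F) | `[< rational_points W P >]}.

Lemma ec_pointP (P : G) : rational_points W (val P).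
Proof. exact/asboolP/(valP P). Qed.

Definition ec_mk P (h : rational_points W P) : G := exist _ P (asboolT h).

Definition ec_add (P Q : G) : G :=
  ec_mk (addp_rational ns (ec_pointP P) (ec_pointP Q)).
Definition ec_opp (P : G) : G := ec_mk (oppp_rational (ec_pointP P)).
Definition ec_zero : G := @ec_mk None I.

Fact ec_addA : associative ec_add.
Proof.
move=> P Q S.
exact/val_inj/(addpA ns (ec_pointP P) (ec_pointP Q) (ec_pointP S)).
Qed.
Fact ec_addC : commutative ec_add.
Proof. by move=> P Q; exact/val_inj/(addpC ns (ec_pointP P) (ec_pointP Q)). Qed.
Fact ec_add0 : left_id ec_zero ec_add.
Proof. by move=> P; apply/val_inj. Qed.
Fact ec_addN : left_inverse ec_zero ec_opp ec_add.
Proof. by move=> P; rewrite ec_addC; apply/val_inj/addpN. Qed.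

HB.instance Definition _ := GRing.isZmodule.Build G
  ec_addA ec_addC ec_add0 ec_addN.

Lemma val_ec_add (P Q : G) : val (P + Q) = addp W (val P) (val Q).
Proof. by []. Qed.

Lemma mulpn_val n (P : G) : mulpn W n (val P) = val (P *+ n).
Proof. by elim: n => // n IH; rewrite mulrS val_ec_add -IH. Qed.

Lemma mulpz_val n (P : G) : mulpz W n (val P) = val (P *~ n).
Proof. by case: n => n; rewrite /mulpz !mulpn_val. Qed.

End PointGroup.

(** If g has infinite order, only 0 is killed by q. If g has order N, then x = k g with k < N and N
    dividing q k, so x is determined by q k / N, a natural number below q. *)
Lemma cyclic_torsion_size (G : zmodType) (g : G) (q : nat) (s : seq G) :
  (0 < q)%N -> uniq s ->
  (forall x, x \in s -> x *+ q = 0 /\ exists n : int, x = g *~ n) ->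
  (size s <= q)%N.
Proof.
move=> q0 us hs.
have [[m /andP[m0 gm]]|nofin] :=
  pselect (exists m, (0 < m)%N && (g *+ m == 0)); last first.
  have s0 x : x \in s -> x = 0.
    move=> /hs[xq [n xn]]; have [n0|n0] := eqVneq n 0; first by rewrite xn n0 mulr0z.
    exfalso; apply: nofin; exists (`|n| * q)%N; rewrite muln_gt0 q0 absz_gt0 n0 /=.
    rewrite mulrnA; have := xq; rewrite xn.
    by case: n {xn n0} => n /eqP //; rewrite NegzE mulrNz mulNrn oppr_eq0.
  apply: leq_trans q0; rewrite -[1%N]/(size [:: (0 : G)]); apply: uniq_leq_size => //.
  by move=> x /s0 ->; rewrite inE.
have ex : exists m, (0 < m)%N && (g *+ m == 0) by exists m; rewrite m0.
case: (ex_minnP ex) => N /andP[N0 /eqP gN] minN {m m0 gm ex}.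
have red x : x \in s -> exists k, [/\ (k < N)%N, x = g *+ k & (N %| q * k)%N].
  move=> /hs[xq [n xn]].
  have xk : x = g *+ `|(n %% N)%Z|%N.
    rewrite xn {1}(divz_eq n N) mulrzDr mulrC mulrzA -pmulrn gN mul0rz add0r.
    by rewrite pmulrn gez0_abs // modz_ge0 // -lt0n.
  exists `|(n %% N)%Z|%N; split => //.
    by rewrite -ltz_nat gez0_abs ?modz_ge0 ?ltz_pmod -?lt0n.
  move: xk; move: `|_|%N => k xk.
  rewrite /dvdn; apply/negPn/negP => nz.
  have := minN (q * k %% N)%N; rewrite lt0n nz /= => /(_ _)/wrap[].
    have : g *+ (q * k) = 0 by rewrite mulnC mulrnA -xk.
    by rewrite {1}(divn_eq (q * k) N) mulrnDr mulnC mulrnA gN mul0rn add0r => ->.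
  by rewrite leqNgt ltn_pmod.
have /choice[f hf] x : exists k,
    x \in s -> [/\ (k < N)%N, x = g *+ k & (N %| q * k)%N].
  have [xs|/negP nxs] := boolP (x \in s); last by exists 0%N.
  by have [k hk] := red _ xs; exists k.
rewrite -(size_map (fun x => (q * f x) %/ N)%N) -[X in (_ <= X)%N](size_iota 0 q).
apply: uniq_leq_size.
  rewrite map_inj_in_uniq // => x y /hf[_ xe xd] /hf[_ ye yd] E.
  have := congr1 (muln^~ N) E; rewrite /= !divnK // => /eqP.
  by rewrite eqn_pmul2l // => /eqP Ef; rewrite xe Ef -ye.
move=> _ /mapP[x /hf[xN _ _] ->]; rewrite mem_iota add0n /=.
by rewrite ltn_divLR // ltn_pmul2l.
Qed.

Lemma cyclic_points_torsion (F : fieldType) (W : weierstrass F) (q : nat)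
    (s : seq (option (F * F))) :
  elliptic W -> cyclic_points W -> (0 < q)%N -> uniq s ->
  (forall P, P \in s -> torsion_points W q P) -> (size s <= q)%N.
Proof.
move=> hW [P CP gen] q0 us hs.
pose s' : seq (ec_point hW) := pmap insub s.
have Es : map val s' = s.
  rewrite /s' pmap_filter; last exact: insubK.
  apply/all_filterP/allP => Q /hs[CQ _].
  by rewrite /= insubT //; apply/asboolP.
rewrite -Es size_map; apply: (@cyclic_torsion_size _ (ec_mk hW CP)) => //.
  by move: us; rewrite -Es => /map_uniq.
move=> x xs; have /hs[Cx xq] : val x \in s by rewrite -Es map_f.
split; first by apply/val_inj; rewrite -mulpn_val.
have [n E] := gen _ Cx; exists n; apply/val_inj.
by rewrite E -[P]/(val (ec_mk hW CP)) mulpz_val.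
Qed.

(** * Torsion points in characteristic zero *)

Section FewRoots.
Variable C : closedFieldType.

(* A polynomial with few roots satisfies a first-order linear differential
   equation, which constrains its coefficients. *)
Lemma deriv_roots_in (p : {poly C}) (s : seq C) :
  p != 0 -> (forall z, root p z -> z \in s) ->
  exists2 L : {poly C}, (size L <= size s)%N &
    p^`() * \prod_(a <- s) ('X - a%:P) = p * L.
Proof.
move=> p0 hs; have [r Er] := closed_field_poly_normal p.
have {hs} hr z : z \in r -> z \in s.
  move=> zr; apply: hs; rewrite Er rootZ ?lead_coef_eq0 //.
  by rewrite root_prod_XsubC.
suff [L sL EL] : exists2 L : {poly C}, (size L <= size s)%N &
    (\prod_(z <- r) ('X - z%:P))^`() * \prod_(a <- s) ('X - a%:P)
      = \prod_(z <- r) ('X - z%:P) * L.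
  by exists L => //; rewrite Er derivZ -!scalerAl EL.
elim: r hr {Er} => [|z r IH] hr.
  by exists 0; rewrite ?size_poly0 // big_nil derivC mul0r mulr0.
have [|L sL EL] := IH; first by move=> w wr; apply: hr; rewrite inE wr orbT.
have zs : z \in s by apply: hr; rewrite inE eqxx.
(* L is the logarithmic derivative of p times the product over [s]: each root z, counted with
   multiplicity, contributes that product without one factor X - z. *)
exists (\prod_(a <- rem z s) ('X - a%:P) + L).
  rewrite (leq_trans (size_polyD _ _)) // geq_max sL andbT.
  rewrite size_prod_XsubC size_rem // prednK //.
  by case: (s) zs.
rewrite big_cons derivM derivXsubC mul1r mulrDl -mulrA EL mulrDr.
rewrite {1}(perm_big _ (perm_to_rem zs)) /= big_cons; ring.
Qed.

Lemma roots_in1 (p : {poly C}) a : p != 0 -> (forall z, root p z -> z = a) ->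
  exists l, forall k,
    p`_k.+1 *+ k.+1 - a * (p`_k.+2 *+ k.+2) = l * p`_k.+1.
Proof.
move=> p0 hs; have [|L sL] := @deriv_roots_in p [:: a] p0.
  by move=> z /hs ->; rewrite inE.
rewrite big_seq1 (size1_polyC sL) => E; exists L`_0 => k.
have := congr1 (fun q : {poly C} => q`_k.+1) E.
rewrite coefMC mulrBr coefB coefMX coefMC !coef_deriv /= => H.
by rewrite [RHS]mulrC -H; ring.
Qed.

Lemma roots_in2 (p : {poly C}) a b : p != 0 ->
  (forall z, root p z -> z = a \/ z = b) ->
  exists l m, forall k,
    p`_k.+1 *+ k.+1 - (a + b) * (p`_k.+2 *+ k.+2) + a * b * (p`_k.+3 *+ k.+3)
      = l * p`_k.+1 + m * p`_k.+2.
Proof.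
move=> p0 hs; have [|L sL] := @deriv_roots_in p [:: a; b] p0.
  by move=> z /hs[] ->; rewrite !inE eqxx ?orbT.
have -> : L = L`_1 *: 'X + (L`_0)%:P.
  apply/polyP => -[|[|k]]; rewrite coefD coefZ coefX coefC /=; try ring.
  by rewrite nth_default ?(leq_trans sL) //; ring.
rewrite big_cons big_seq1 => E; exists L`_1, L`_0 => k.
have := congr1 (fun q : {poly C} => q`_k.+2) E.
have -> : p^`() * (('X - a%:P) * ('X - b%:P)) =
   p^`() * 'X * 'X - p^`() * 'X * (a + b)%:P + p^`() * (a * b)%:P.
  by rewrite polyCD polyCM; ring.
rewrite mulrDr -scalerAr !(coefD, coefN, coefMC, coefMX, coefZ, coef_deriv) /=.
by move=> H; rewrite [in RHS](mulrC (L`_0)) -H; ring.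
Qed.

Lemma ex_root (p : {poly C}) n : (1 < n)%N -> p`_n.-1 != 0 -> exists a, root p a.
Proof.
move=> n1 pn; apply/closed_rootP.
rewrite gtn_eqF //; apply: leq_trans n1 _; rewrite leqNgt.
by apply: contra pn => sp; rewrite nth_default // -ltnS prednK // (leq_trans _ sp).
Qed.

End FewRoots.

(** * Division polynomials of a short Weierstrass equation *)

Section ShortTorsion.
Variables (C : numClosedFieldType) (A B : C).
Let S := Weierstrass 0 0 0 A B.
Hypothesis hS : elliptic S.

Lemma short_disc : 4 * A ^+ 3 + 27 * B ^+ 2 != 0.
Proof.
apply: contra hS => /eqP E; rewrite /disc /b2 /b4 /b6 /b8 /=.
suff -> : - (0 ^+ 2 + 4 * 0) ^+ 2 *
 (0 ^+ 2 * B + 4 * 0 * B - 0 * 0 * A + 0 * 0 ^+ 2 - A ^+ 2) -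
 8 * (2 * A + 0 * 0) ^+ 3 - 27 * (0 ^+ 2 + 4 * B) ^+ 2 +
 9 * (0 ^+ 2 + 4 * 0) * (2 * A + 0 * 0) * (0 ^+ 2 + 4 * B) =
  -16 * (4 * A ^+ 3 + 27 * B ^+ 2) by rewrite E mulr0.
by ring.
Qed.

Lemma short_AB0 : A = 0 -> B = 0 -> False.
Proof. by have := short_disc => + A0 B0; rewrite A0 B0 !expr0n !mulr0 addr0 eqxx. Qed.

(** Coefficients start at the constant term. [psi2] is the cubic x^3 + A x + B, a quarter of the
    square of the 2-division polynomial 2 y; [psi3] and [psi5] are the usual division
    polynomials. *)
Definition psi2 : {poly C} := Poly [:: B; A; 0; 1].
Definition psi3 : {poly C} := Poly [:: - A ^+ 2; 12 * B; 6 * A; 0; 3].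
Definition psi5 : {poly C} := Poly
  [:: A ^+ 6 - 32 * A ^+ 3 * B ^+ 2 - 256 * B ^+ 4;
      - 100 * A ^+ 4 * B - 640 * A * B ^+ 3;
      - 50 * A ^+ 5 - 240 * A ^+ 2 * B ^+ 2;
      - 80 * A ^+ 3 * B - 1600 * B ^+ 3;
      - 125 * A ^+ 4 - 1920 * A * B ^+ 2;
      - 696 * A ^+ 2 * B;
      - 300 * A ^+ 3 - 240 * B ^+ 2;
      240 * A * B; - 105 * A ^+ 2; 380 * B; 62 * A; 0; 5].

Lemma on_shortE x y : on_curve S x y <-> y ^+ 2 = x ^+ 3 + A * x + B.
Proof.
rewrite /on_curve /=; split => H.
  by transitivity (y ^+ 2 + 0 * x * y + 0 * y); [ring | rewrite H; ring].
by transitivity (y ^+ 2); [ring | rewrite H; ring].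
Qed.

Lemma oppp_short x y : oppp S (Some (x, y)) = Some (x, - y).
Proof. by rewrite /oppp /=; congr (Some (_, _)); ring. Qed.

(* [psi4_val] is the 4-division polynomial divided by 4 y; the 5-division
   polynomial is then 32 y^4 psi4_val - psi3_val^3. *)
Definition psi3_val x := 3 * x ^+ 4 + 6 * A * x ^+ 2 + 12 * B * x - A ^+ 2.
Definition psi4_val x := x ^+ 6 + 5 * A * x ^+ 4 + 20 * B * x ^+ 3
  - 5 * A ^+ 2 * x ^+ 2 - 4 * A * B * x - 8 * B ^+ 2 - A ^+ 3.

Lemma addp_short_double x y : on_curve S x y -> y != 0 ->
  addp S (Some (x, y)) (Some (x, y)) =
  Some (x - psi3_val x / (4 * y ^+ 2), psi4_val x / (8 * y ^+ 3)).
Proof.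
move=> /on_shortE H y0; rewrite /addp oppp_short.
have -> : (Some (x, y) == Some (x, - y)) = false.
  apply/eqP => -[] /eqP; rewrite -subr_eq0 opprK -mulr2n.
  by rewrite mulrn_eq0 (negPf y0).
rewrite eqxx /= !(mul0r, addr0, subr0, mulr0).
have EB : B = y ^+ 2 - x ^+ 3 - A * x by rewrite H; ring.
by congr (Some (_, _)); rewrite /psi3_val /psi4_val EB; field.
Qed.

Lemma psi2_root x : root psi2 x -> torsion_points S 2 (Some (x, 0)).
Proof.
rewrite /root horner_Poly /= => /eqP H; split.
  by apply/on_shortE; rewrite expr0n /=; rewrite -[LHS]H; ring.
have E : oppp S (Some (x, 0)) = Some (x, 0) by rewrite oppp_short oppr0.
by change (addp S (Some (x, 0)) (Some (x, 0)) = None); rewrite -{2}E addpN.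
Qed.

(** By duplication, a root of [psi3] has x(2P) = x(P), and there [psi4_val] equals -8 y^4, so 2P =
    -P. With y = 0, [psi3_val] would be -(3 x^2 + A)^2, making x a double root of the cubic. *)
Lemma psi3_root x y : root psi3 x -> on_curve S x y ->
  y != 0 /\ torsion_points S 3 (Some (x, y)).
Proof.
rewrite /root horner_Poly /= => /eqP R0 CS; have /on_shortE H := CS.
have {}R0 : psi3_val x = 0 by rewrite -[RHS]R0 /psi3_val; ring.
have y0 : y != 0.
  apply/eqP => y0; move: H; rewrite y0 expr0n /= => H.
  have EB : B = - x ^+ 3 - A * x.
    by transitivity (x ^+ 3 + A * x + B - x ^+ 3 - A * x); [ring | rewrite -H; ring].
  have Z : 3 * x ^+ 2 + A = 0.
    apply/eqP; rewrite -sqrf_eq0 -oppr_eq0 -R0 /psi3_val EB; apply/eqP; ring.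
  have EA : A = - (3 * x ^+ 2).
    by transitivity (3 * x ^+ 2 + A - 3 * x ^+ 2); [ring | rewrite Z; ring].
  by have /eqP := short_disc; apply; rewrite EB EA; ring.
split => //; split => //.
change (addp S (Some (x, y)) (addp S (Some (x, y)) (Some (x, y))) = None).
rewrite addp_short_double // R0 mul0r subr0.
suff -> : psi4_val x / (8 * y ^+ 3) = - y by rewrite -oppp_short addpN.
have EB : B = y ^+ 2 - x ^+ 3 - A * x by rewrite H; ring.
have -> : psi4_val x = - 8 * y ^+ 4 + psi3_val x * (3 * x ^+ 2 + A).
  rewrite /psi4_val /psi3_val EB; ring.
by rewrite R0; field.
Qed.

Lemma psi5_root x y : root psi5 x -> on_curve S x y ->
  y != 0 /\ torsion_points S 5 (Some (x, y)).
Proof.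
rewrite /root horner_Poly /= => /eqP R0 CS; have /on_shortE H := CS.
have EB : B = y ^+ 2 - x ^+ 3 - A * x by rewrite H; ring.
have {}R0 : 32 * y ^+ 4 * psi4_val x - psi3_val x ^+ 3 = 0.
  by rewrite -[RHS]R0 /psi3_val /psi4_val EB; ring.
have y0 : y != 0.
  apply/eqP => y0; move: R0; rewrite y0 => R0.
  (* With y = 0 the 5-division polynomial becomes a sixth power, and x is again a double root of the
     cubic. *)
  have Z : 3 * x ^+ 2 + A = 0.
    have /eqP : (3 * x ^+ 2 + A) ^+ 6 = 0.
      by rewrite -[RHS]R0 /psi3_val EB y0; ring.
    by rewrite expf_eq0 /= => /eqP.
  have EA : A = - (3 * x ^+ 2).
    by transitivity (3 * x ^+ 2 + A - 3 * x ^+ 2); [ring | rewrite Z; ring].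
  by have /eqP := short_disc; apply; rewrite EB EA y0; ring.
split => //; split => //.
(* Otherwise [psi4_val] is -8 y^4, and the 5-division polynomial takes the nonzero value -256
   y^8. *)
have p30 : psi3_val x != 0.
  apply/eqP => p30; move/eqP: R0; rewrite p30 expr0n subr0.
  have -> : psi4_val x = - 8 * y ^+ 4 + psi3_val x * (3 * x ^+ 2 + A).
    rewrite /psi4_val /psi3_val EB; ring.
  rewrite p30 mul0r addr0; apply/negP.
  by rewrite !mulf_neq0 ?oppr_eq0 ?expf_neq0 ?pnatr_eq0.
pose g : ec_point hS := @ec_mk _ _ hS (Some (x, y)) CS.
(* The x-coordinates of 2P and 3P agree iff the chord through P and 2P has
   squared slope x(P) + 2 x(2P), and then 3P = -2P. *)
suff E : g *+ 2 + g = - (g *+ 2).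
  change (mulpn S 5 (val g) = None); rewrite mulpn_val.
  suff -> : g *+ 5 = 0 by [].
  by rewrite (mulrnDr g 3 2) (mulrSr g 2) E addNr.
set x2 := x - psi3_val x / (4 * y ^+ 2).
set y2 := psi4_val x / (8 * y ^+ 3).
have dbl : val (g *+ 2) = Some (x2, y2) by rewrite -addp_short_double.
have d0 : x2 - x != 0.
  by rewrite /x2 addrAC subrr sub0r oppr_eq0 mulf_neq0 // invr_eq0 mulf_neq0
    ?pnatr_eq0 // expf_neq0.
apply/val_inj; rewrite addrC val_ec_add [val g]/=.
change (addp S (Some (x, y)) (val (g *+ 2)) = oppp S (val (g *+ 2))).
rewrite dbl /addp; case: eqVneq => [|_].
  by rewrite oppp_short => -[E _]; rewrite E subrr eqxx in d0.
case: eqVneq => [E|_]; first by rewrite -E subrr eqxx in d0.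
set lam := (y2 - y) / (x2 - x).
suff L2 : lam ^+ 2 = x + 2 * x2.
  have E : lam ^+ 2 + a1 S * lam - a2 S - x - x2 = x2 by rewrite L2 /=; ring.
  by rewrite E; congr (oppp _ (Some (_, _))); rewrite /lam; field.
apply: (mulfI (expf_neq0 2 d0)).
have -> : (x2 - x) ^+ 2 * lam ^+ 2 = (y2 - y) ^+ 2 by rewrite /lam; field.
have -> : (y2 - y) ^+ 2 = (x2 - x) ^+ 2 * (x + 2 * x2) -
    (32 * y ^+ 4 * psi4_val x - psi3_val x ^+ 3) / (64 * y ^+ 6).
  by rewrite /x2 /y2 /psi3_val /psi4_val EB; field.
by rewrite R0 mul0r subr0.
Qed.

End ShortTorsion.

(** * Enough roots of the division polynomials *)

Section ShortTorsionCount.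
Variables (C : numClosedFieldType) (A B : C).
Let S := Weierstrass 0 0 0 A B.
Hypothesis hS : elliptic S.

(** With a single root a, the leading coefficient makes l the degree, the missing subleading one
    gives a = 0, and the next gives A = 0. The relations do not reach the constant term; B = 0 comes
    from 0 being a root. *)
Lemma psi2_other_root a : exists2 c, root (psi2 A B) c & c != a.
Proof.
apply: contrapT => N; have hs z : root (psi2 A B) z -> z = a.
  by move=> rz; apply/eqP/negPn/negP => za; apply: N; exists z.
have p3 : (psi2 A B)`_3 != 0 by rewrite coef_Poly /= oner_eq0.
have [z rz] : exists z, root (psi2 A B) z by exact: (@ex_root _ _ 4).
have p0 : psi2 A B != 0 by apply: contraNneq p3 => ->; rewrite coef0.
have [l H] := roots_in1 p0 hs.
have := (H 2%N, H 1%N, H 0%N); rewrite !coef_Poly /= => -[[H2 H1] H0].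
have El : l = 3 by rewrite -[LHS]mulr1 -H2; ring.
have Ea : a = 0.
  by transitivity (- (l * 0) / 3); [rewrite -H1; field | rewrite mulr0 oppr0 mul0r].
have EA : A = 0.
  by transitivity ((l * A - A) / 2); [rewrite El; field | rewrite -H0 Ea; field].
apply: (short_AB0 hS EA); rewrite -(hs _ rz) in Ea.
move: rz; rewrite Ea /root horner_Poly /=.
by rewrite mulr0 add0r => /eqP.
Qed.

Lemma psi3_other_root a : exists2 c, root (psi3 A B) c & c != a.
Proof.
apply: contrapT => N; have hs z : root (psi3 A B) z -> z = a.
  by move=> rz; apply/eqP/negPn/negP => za; apply: N; exists z.
have p3 : (psi3 A B)`_4 != 0 by rewrite coef_Poly /= pnatr_eq0.
have p0 : psi3 A B != 0 by apply: contraNneq p3 => ->; rewrite coef0.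
have [l H] := roots_in1 p0 hs.
have := (H 3%N, H 2%N, H 1%N, H 0%N); rewrite !coef_Poly /= => -[[[H3 H2] H1] H0].
have El : l = 4.
  by transitivity (l * 3 / 3); [field | rewrite -H3; field].
have Ea : a = 0.
  by transitivity (- (l * 0) / 12); [rewrite -H2; field | rewrite mulr0 oppr0 mul0r].
have EA : A = 0.
  transitivity ((l * (6 * A) - 12 * A) / 12); first by rewrite El; field.
  by rewrite -H1 Ea; field.
apply: (short_AB0 hS EA).
transitivity ((l * (12 * B) - 12 * B) / 36); first by rewrite El; field.
by rewrite -H0 Ea; field.
Qed.

(** Two roots would give only five points. If all roots are among a and b, the top relations express
    l, m, t = a b and B through A and s = a + b; the next two force A = 0, hence B = 0. *)
Lemma psi5_other_root a b : exists2 c, root (psi5 A B) c & (c != a) && (c != b).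
Proof.
apply: contrapT => N; have hs z : root (psi5 A B) z -> z = a \/ z = b.
  move=> rz; have [->|za] := eqVneq z a; first by left.
  have [->|zb] := eqVneq z b; first by right.
  by exfalso; apply: N; exists z; rewrite ?za.
have p3 : (psi5 A B)`_12 != 0 by rewrite coef_Poly /= pnatr_eq0.
have p0 : psi5 A B != 0 by apply: contraNneq p3 => ->; rewrite coef0.
have [l [m H]] := roots_in2 p0 hs.
have := (H 11%N, H 10%N, H 9%N, H 8%N, H 7%N, H 6%N); rewrite !coef_Poly /=.
move: (a + b) (a * b) => s t [[[[[H11 H10] H9] H8] H7] H6].
have El : l = 12.
  transitivity ((l * 5 + m * 0) / 5); first by field.
  by rewrite -H11; field.
have Em : m = - 12 * s.
  transitivity ((l * 0 + m * 5) / 5); first by field.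
  by rewrite -H10; field.
have Et : t = 31 / 15 * A.
  transitivity ((l * (62 * A) + m * 0 - 620 * A) / 60); last by rewrite El; field.
  by rewrite -H9; field.
have EB : B = 31 / 285 * (s * A).
  transitivity ((l * (380 * B) + m * (62 * A) - 3420 * B + 744 * s * A) / 1140).
    by rewrite El Em; field.
  by rewrite -H8; field.
have As : A ^+ 2 * s = 0.
  (* After substituting [El], [Em], [Et] and [EB], the relation [H6] reads -(4 72^2 / 95) A^2 s =
     0. *)
  transitivity (- (l * (240 * A * B) + m * (- 105 * A ^+ 2)
     - (240 * A * B *+ 7 - s * (- 105 * A ^+ 2 *+ 8) + t * (380 * B *+ 9)))
     * 95 / (4 * 72 * 72)).
    by rewrite El Em Et EB; field.
  by rewrite -H6; field.
have A0 : A = 0.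
  have : A ^+ 2 * s = 0 by [].
  move/eqP; rewrite mulf_eq0 expf_eq0 /= => /orP[/eqP //|/eqP s0].
  apply/eqP; rewrite -sqrf_eq0; apply/eqP.
  transitivity (- (l * (- 105 * A ^+ 2) + m * (380 * B) - (- 105 * A ^+ 2 *+ 8
     - s * (380 * B *+ 9) + t * (62 * A *+ 10))) / (420 + 620 * 31 / 15)).
    by rewrite El Em Et s0; field.
  by rewrite -H7; field.
by apply: (short_AB0 hS A0); rewrite EB A0; ring.
Qed.

Lemma psi_points x : exists y, on_curve S x y.
Proof.
by exists (sqrtC (x ^+ 3 + A * x + B)); apply/on_shortE; rewrite sqrtCK.
Qed.

(** The counts are 1 + 1 + 1, 1 + 2 + 1 and 1 + 2 + 2 + 1: infinity, then the points above
    successive roots, two opposite ones whenever y and -y are both taken. *)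
Lemma short_torsion q : q \in [:: 2; 3; 5]%N ->
  exists s, [/\ uniq s, size s = q.+1 & forall P, P \in s -> torsion_points S q P].
Proof.
have None_torsion n : torsion_points S n None by split=> //; elim: n => //= n ->.
have neq_opp (y : C) : y != 0 -> (y == - y) = false.
  by move=> y0; rewrite -subr_eq0 opprK -mulr2n mulrn_eq0 (negPf y0).
have oppS x y : on_curve S x y -> on_curve S x (- y).
  by move=> /on_shortE H; apply/on_shortE; rewrite sqrrN.
have neq_abs (x x' u u' : C) : x' != x -> (Some (x, u) == Some (x', u')) = false.
  by move=> xx'; apply/eqP; case=> E; rewrite E eqxx in xx'.
have neq_ord (x u : C) : u != 0 -> (Some (x, u) == Some (x, - u)) = false.
  by move=> u0; apply/eqP; case=> /eqP; rewrite neq_opp.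
rewrite !inE => /or3P[] /eqP ->.
- have [a ra _] := psi2_other_root 0; have [b rb ba] := psi2_other_root a.
  exists [:: None; Some (a, 0); Some (b, 0)]; split => //.
    by rewrite /= !inE !neq_abs.
  by move=> P; rewrite !inE => /or3P[] /eqP -> //; apply: psi2_root.
- have [a ra _] := psi3_other_root 0; have [b rb ba] := psi3_other_root a.
  have [[y Cy] [z Cz]] := (psi_points a, psi_points b).
  have [y0 Ty] := psi3_root hS ra Cy; have [z0 Tz] := psi3_root hS rb Cz.
  have [_ Ty'] := psi3_root hS ra (oppS _ _ Cy).
  exists [:: None; Some (a, y); Some (a, - y); Some (b, z)]; split => //.
    by rewrite /= !inE !neq_ord // !neq_abs.
  by move=> P; rewrite !inE => /or4P[] /eqP ->.
have [a ra _] := psi5_other_root 0 0; have [b rb /andP[ba _]] := psi5_other_root a a.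
have [c rc /andP[ca cb]] := psi5_other_root a b.
have [[y Cy] [z Cz]] := (psi_points a, psi_points b); have [w Cw] := psi_points c.
have [y0 Ty] := psi5_root hS ra Cy; have [z0 Tz] := psi5_root hS rb Cz.
have [w0 Tw] := psi5_root hS rc Cw.
have [_ Ty'] := psi5_root hS ra (oppS _ _ Cy).
have [_ Tz'] := psi5_root hS rb (oppS _ _ Cz).
exists [:: None; Some (a, y); Some (a, - y); Some (b, z); Some (b, - z); Some (c, w)].
split => //; last first.
  by move=> P; rewrite !inE => /or4P[/eqP ->|/eqP ->|/eqP ->|/or3P[] /eqP ->].
by rewrite /= !inE !neq_ord // !neq_abs // eq_sym.
Qed.

End ShortTorsionCount.

(** * Torsion under a change of Weierstrass equation *)

Section ChangeOfVariables.
Variables (F : fieldType) (W : weierstrass F) (u r s t : F).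
Hypothesis u0 : u != 0.
Let W' := change_of_variables W u r s t.

Definition cov_point (P : option (F * F)) : option (F * F) :=
  if P is Some (x, y)
  then Some ((x - r) / u ^+ 2, (y - s * (x - r) - t) / u ^+ 3) else None.

Definition cov_inv (P : option (F * F)) : option (F * F) :=
  if P is Some (x, y)
  then Some (u ^+ 2 * x + r, u ^+ 3 * y + u ^+ 2 * s * x + t) else None.

Lemma cov_pointK : cancel cov_point cov_inv.
Proof. by case=> [[x y]|//] /=; congr (Some (_, _)); field. Qed.

Lemma cov_invK : cancel cov_inv cov_point.
Proof. by case=> [[x y]|//] /=; congr (Some (_, _)); field. Qed.

Lemma cov_rational P :
  rational_points W' (cov_point P) <-> rational_points W P.
Proof.
case: P => [[x y]|//].
rewrite /cov_point /rational_points /=.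
set l' := (X in X = _ <-> _); set r' := (X in _ = X <-> _).
set l := (X in _ <-> X = _); set r0 := (X in _ <-> _ = X).
have E : l' - r' = (l - r0) / u ^+ 6 by rewrite /l' /r' /l /r0; field.
split=> [/eqP|/eqP] H; apply/eqP; rewrite -subr_eq0; move: H.
  by rewrite -subr_eq0 E mulf_eq0 invr_eq0 expf_eq0 /= (negPf u0) orbF.
by rewrite -subr_eq0 E => /eqP ->; rewrite mul0r.
Qed.

Lemma cov_oppp P : oppp W' (cov_point P) = cov_point (oppp W P).
Proof. by case: P => [[x y]|//] /=; congr (Some (_, _)); field. Qed.

Lemma cov_addp P Q : rational_points W P -> rational_points W Q ->
  addp W' (cov_point P) (cov_point Q) = cov_point (addp W P Q).
Proof.
case: P => [[x1 y1]|//]; case: Q => [[x2 y2]|//] C1 C2.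
have CE : (cov_point (Some (x2, y2)) == oppp W' (cov_point (Some (x1, y1))))
    = (Some (x2, y2) == oppp W (Some (x1, y1))).
  by rewrite cov_oppp (can_eq cov_pointK).
move: CE; rewrite [cov_point]lock /addp -lock.
rewrite [cov_point (Some (x1, y1))]/cov_point [cov_point (Some (x2, y2))]/cov_point.
move=> ->; case: eqVneq => // N.
have E12 : ((x1 - r) / u ^+ 2 == (x2 - r) / u ^+ 2) = (x1 == x2).
  have u2 : (u ^+ 2)^-1 != 0 by rewrite invr_eq0 expf_neq0.
  by rewrite (inj_eq (mulIf u2)) (inj_eq (addIr (- r))).
rewrite E12 -cov_oppp; set l' := (if _ then _ else _).
set l := (if x1 == x2 then _ else _).
(* The substitution carries a line of slope [l] to one of slope (l - s) / u. *)
suff -> : l' = (l - s) / u.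
  by congr (oppp _ (Some (_, _))) => /=; field.
rewrite /l' /l; case: eqVneq => [E|D].
  rewrite -E in C2 N; have [Ey nz] := same_abscissa C1 C2 N.
  rewrite [X in _ / X = _](_ : _ = (2 * y1 + a1 W * x1 + a3 W) / u ^+ 3); last first.
    by rewrite /=; field.
  rewrite [X in X / _ = _](_ : _ = (3 * x1 ^+ 2 + 2 * a2 W * x1 + a4 W - a1 W * y1
     - s * (2 * y1 + a1 W * x1 + a3 W)) / u ^+ 4).
    by move: (2 * y1 + _ + _) nz => d nz; field; rewrite u0.
  by rewrite /=; field.
have d0 : x2 - x1 != 0 by rewrite subr_eq0 eq_sym.
have -> : (x2 - r) / u ^+ 2 - (x1 - r) / u ^+ 2 = (x2 - x1) / u ^+ 2 by field.
have -> : (y2 - s * (x2 - r) - t) / u ^+ 3 - (y1 - s * (x1 - r) - t) / u ^+ 3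
   = (y2 - y1 - s * (x2 - x1)) / u ^+ 3 by field.
by move: (x2 - x1) d0 => d d0; field; rewrite u0.
Qed.

Lemma cov_mulpn n P : elliptic W -> rational_points W P ->
  mulpn W' n (cov_point P) = cov_point (mulpn W n P).
Proof.
move=> hW CP; suff : rational_points W (mulpn W n P) /\
    mulpn W' n (cov_point P) = cov_point (mulpn W n P) by case.
elim: n => [//|n [Cn IH]].
split; first exact: (addp_rational (elliptic_nonsingular hW) CP Cn).
change (addp W' (cov_point P) (mulpn W' n (cov_point P)) =
  cov_point (addp W P (mulpn W n P))).
by rewrite IH cov_addp.
Qed.

Lemma cov_torsion n P : elliptic W ->
  torsion_points W' n (cov_point P) <-> torsion_points W n P.
Proof.
move=> hW; split=> -[].
  move=> /cov_rational CP; rewrite cov_mulpn //.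
  move=> /(can_inj cov_pointK (x2 := None)) H.
  by split.
by move=> CP H; split; [apply/cov_rational | rewrite cov_mulpn // H].
Qed.

Lemma cov_disc : disc W' * u ^+ 12 = disc W.
Proof. by rewrite /disc /b2 /b4 /b6 /b8 /=; field. Qed.

End ChangeOfVariables.

Lemma weierstrass_torsion (C : numClosedFieldType) (W : weierstrass C) q :
  elliptic W -> q \in [:: 2; 3; 5]%N ->
  exists s, [/\ uniq s, size s = q.+1 & forall P, P \in s -> torsion_points W q P].
Proof.
move=> hW hq.
(* Completing the square and the cube: [s] removes [a1], [r] removes [a2], and [t] removes [a3]. *)
pose s := - a1 W / 2; pose r := - (a1 W ^+ 2 + 4 * a2 W) / 12.
pose t := - (a3 W + r * a1 W) / 2.
pose S := change_of_variables W 1 r s t.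
have u0 : (1 : C) != 0 by exact: oner_neq0.
have ES : S = Weierstrass 0 0 0 (a4 S) (a6 S).
  by rewrite /S /change_of_variables; congr Weierstrass;
    rewrite /= /t /s /r; field.
have hS : elliptic (Weierstrass 0 0 0 (a4 S) (a6 S)).
  rewrite -ES; have := hW; rewrite /elliptic -(cov_disc W r s t u0).
  by rewrite expr1n mulr1.
have [l [ul sl hl]] := short_torsion hS hq.
exists (map (cov_inv 1 r s t) l); split.
- by rewrite map_inj_uniq //; apply: can_inj (cov_invK r s t u0).
- by rewrite size_map.
move=> _ /mapP[P Pl ->]; apply/(cov_torsion r s t u0 q (cov_inv 1 r s t P) hW).
by rewrite cov_invK //; have := hl _ Pl; rewrite -ES.
Qed.

(** * Transport of torsion along field embeddings *)

Section FieldMorphism.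
Variables (K L : fieldType) (h : {rmorphism K -> L}) (W : weierstrass K).

Definition map_point (A B : Type) (g : A -> B) (P : option (A * A)) :=
  omap (fun p => (g p.1, g p.2)) P.

Lemma map_point_inj : injective (map_point h).
Proof.
by move=> [[x y]|] [[x' y']|] //= [/fmorph_inj -> /fmorph_inj ->].
Qed.

Lemma map_rational P :
  rational_points (map_weierstrass h W) (map_point h P) <-> rational_points W P.
Proof.
case: P => [[x y]|] //=.
rewrite -!rmorphXn -!rmorphM -!rmorphD; split=> [/fmorph_inj //|].
by move->.
Qed.

Lemma map_oppp P :
  oppp (map_weierstrass h W) (map_point h P) = map_point h (oppp W P).
Proof.
by case: P => [[x y]|] //=; rewrite !rmorphB !rmorphM rmorphN.
Qed.

Lemma map_addp P Q :
  addp (map_weierstrass h W) (map_point h P) (map_point h Q) =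
  map_point h (addp W P Q).
Proof.
case: P Q => [[x1 y1]|] [[x2 y2]|] //.
rewrite [LHS]/addp.
have := map_oppp (Some (x1, y1)); rewrite [map_point h (Some _)]/= => ->.
have -> : (Some (h x2, h y2) == map_point h (oppp W (Some (x1, y1)))) =
   (Some (x2, y2) == oppp W (Some (x1, y1))).
  exact: (inj_eq map_point_inj (Some (x2, y2))).
rewrite /addp; case: eqVneq => // _.
rewrite -map_oppp (_ : map_point h (Some (x2, y2)) = Some (h x2, h y2)) //.
rewrite (inj_eq (fmorph_inj h)).
set l' := (if _ then _ else _); set l := (if x1 == x2 then _ else _).
have -> : l' = h l.
  by rewrite /l /l'; case: ifP => _;
    rewrite fmorph_div !(rmorphD, rmorphN, rmorphM, rmorphXn, rmorph_nat).
by congr (oppp _ (Some (_, _)));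
  rewrite /= !(rmorphD, rmorphN, rmorphM, rmorphXn).
Qed.

Lemma map_mulpn n P :
  mulpn (map_weierstrass h W) n (map_point h P) = map_point h (mulpn W n P).
Proof. by elim: n => // n IH; rewrite -map_addp -IH. Qed.

Lemma map_torsion n P :
  torsion_points (map_weierstrass h W) n (map_point h P) <->
  torsion_points W n P.
Proof.
rewrite /torsion_points /= map_mulpn; split=> -[/map_rational CP H]; split => //.
  by apply: map_point_inj; rewrite H.
by rewrite H.
Qed.

End FieldMorphism.

(** * Reduction at almost all primes *)

(* [Red x c] means that c is the reduction of x; it is undefined at the elements
   that are not integral at the chosen place. *)
Section PartialMorphism.
Variables (K L : fieldType) (Red : K -> L -> Prop).

(** By additivity the last clause makes the relation single-valued. *)
Definition partial_morphism :=
  [/\ Red 1 1,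
      forall x y c d, Red x c -> Red y d -> Red (x + y) (c + d),
      forall x c, Red x c -> Red (- x) (- c),
      forall x y c d, Red x c -> Red y d -> Red (x * y) (c * d) &
      forall c, Red 0 c -> c = 0].

Hypothesis pm : partial_morphism.

Let Red1 : Red 1 1. Proof. by case: pm. Qed.
Let RedD x y c d : Red x c -> Red y d -> Red (x + y) (c + d).
Proof. by case: pm => _ H _ _ _; apply: H. Qed.
Let RedN x c : Red x c -> Red (- x) (- c).
Proof. by case: pm => _ _ H _ _; apply: H. Qed.
Let RedM x y c d : Red x c -> Red y d -> Red (x * y) (c * d).
Proof. by case: pm => _ _ _ H _; apply: H. Qed.
Let Red_0 c : Red 0 c -> c = 0. Proof. by case: pm => _ _ _ _; apply. Qed.

Lemma red_nat n : Red n%:R n%:R.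
Proof.
elim: n => [|n IH]; last by rewrite -!natr1; apply: RedD.
by have := RedD Red1 (RedN Red1); rewrite !subrr.
Qed.

Lemma red_exp x c n : Red x c -> Red (x ^+ n) (c ^+ n).
Proof. by move=> H; elim: n => [//|n IH]; rewrite !exprS; apply: RedM. Qed.

Lemma red_fun x c d : Red x c -> Red x d -> c = d.
Proof.
move=> Hc Hd; apply/eqP; rewrite -subr_eq0; apply/eqP/Red_0.
by rewrite -(subrr x); apply: RedD => //; apply: RedN.
Qed.

Lemma red_neq0 x c e : Red x c -> Red x^-1 e -> x != 0 -> c != 0.
Proof.
move=> Hc He x0; apply/eqP => c0.
have := RedM Hc He; rewrite mulfV // c0 mul0r => H.
by have /eqP := red_fun Red1 H; rewrite oner_eq0.
Qed.

Lemma red_inv x c e : Red x c -> Red x^-1 e -> Red x^-1 c^-1.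
Proof.
move=> Hc He; have [x0|x0] := eqVneq x 0.
  have c0 : c = 0 by apply: Red_0; rewrite -x0.
  by rewrite c0 invr0 x0 invr0; exact: (red_nat 0).
have c0 := red_neq0 Hc He x0.
suff -> : c^-1 = e by [].
apply: (mulfI c0); rewrite mulfV //; apply: (red_fun Red1).
by rewrite -(mulfV x0); apply: RedM.
Qed.

(** If x and y differ, x - y and its inverse both reduce, so x - y reduces to a unit. *)
Lemma red_eq x y c d e : Red x c -> Red y d -> Red (x - y)^-1 e ->
  (c == d) = (x == y).
Proof.
move=> Hc Hd He; have H : Red (x - y) (c - d) by apply: RedD => //; apply: RedN.
rewrite -subr_eq0 -[RHS]subr_eq0; have [E|N] := eqVneq (x - y) 0.
  by apply/eqP/Red_0; rewrite -E.
by apply/negbTE/(red_neq0 H He).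
Qed.

Definition red_curve (W : weierstrass K) (W' : weierstrass L) :=
  [/\ Red (a1 W) (a1 W'), Red (a2 W) (a2 W'), Red (a3 W) (a3 W'),
      Red (a4 W) (a4 W') & Red (a6 W) (a6 W')].

Definition red_point (P : option (K * K)) (P' : option (L * L)) : Prop :=
  match P, P' with
  | Some (x, y), Some (x', y') => Red x x' /\ Red y y'
  | None, None => True
  | _, _ => False
  end.

Ltac reduce_terms := repeat first [assumption
  | match goal with
    | |- Red (_ + _) _ => apply: RedD
    | |- Red (- _) _ => apply: RedN
    | |- Red (_ * _) _ => apply: RedM
    | |- Red (_ ^+ _) _ => apply: red_exp
    | |- Red (_%:R) _ => apply: red_nat
    end].

Variables (W : weierstrass K) (W' : weierstrass L).
Hypothesis hW : red_curve W W'.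

Lemma red_rational P P' : red_point P P' -> rational_points W P ->
  rational_points W' P'.
Proof.
case: hW => h1 h2 h3 h4 h6.
case: P P' => [[x y]|] [[x' y']|] //= [hx hy] C.
apply: (@red_fun (y ^+ 2 + a1 W * x * y + a3 W * y)); first by reduce_terms.
by rewrite C; reduce_terms.
Qed.

Lemma red_oppp P P' : red_point P P' -> red_point (oppp W P) (oppp W' P').
Proof.
case: hW => h1 h2 h3 h4 h6.
by case: P P' => [[x y]|] [[x' y']|] //= [hx hy]; split => //; reduce_terms.
Qed.

(** The inverses behind the equality tests of [addp] and behind its chord and tangent slopes; both
    signs of x1 - x2 occur because the tests compare in both orders. *)
Definition denominators (P Q : option (K * K)) : seq K :=
  if (P, Q) is (Some (x1, y1), Some (x2, y2)) then
    [:: (x1 - x2)^-1; (x2 - x1)^-1; (y2 - (- y1 - a1 W * x1 - a3 W))^-1;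
        (2 * y1 + a1 W * x1 + a3 W)^-1]
  else [::].

Lemma red_addp P Q P' Q' : red_point P P' -> red_point Q Q' ->
  (forall x, x \in denominators P Q -> exists c, Red x c) ->
  red_point (addp W P Q) (addp W' P' Q').
Proof.
case: hW => h1 h2 h3 h4 h6.
case: P P' => [[x1 y1]|] [[x1' y1']|] //; case: Q Q' => [[x2 y2]|] [[x2' y2']|] //.
move=> [hx1 hy1] [hx2 hy2] hd.
have [d1 hd1] : exists c, Red (x1 - x2)^-1 c.
  by apply: hd; rewrite !inE eqxx.
have [d2 hd2] : exists c, Red (x2 - x1)^-1 c.
  by apply: hd; rewrite !inE eqxx orbT.
have [d3 hd3] : exists c, Red (y2 - (- y1 - a1 W * x1 - a3 W))^-1 c.
  by apply: hd; rewrite !inE eqxx !orbT.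
have [d4 hd4] : exists c, Red (2 * y1 + a1 W * x1 + a3 W)^-1 c.
  by apply: hd; rewrite !inE eqxx !orbT.
rewrite /addp.
have -> : (Some (x2', y2') == oppp W' (Some (x1', y1'))) =
    (Some (x2, y2) == oppp W (Some (x1, y1))).
  rewrite /oppp -![Some _ == Some _]/((_, _) == (_, _)) !xpair_eqE.
  rewrite (red_eq hx2 hx1 hd2).
  by rewrite (@red_eq y2 (- y1 - a1 W * x1 - a3 W) _ _ d3) //; reduce_terms.
case: eqVneq => // _.
rewrite (red_eq hx1 hx2 hd1).
set l := (if _ then _ else _); set l' := (if x1 == x2 then _ else _).
have hl : Red l l'.
  rewrite /l /l'; case: ifP => _; apply: RedM; try by reduce_terms.
    by apply: red_inv hd4; reduce_terms.
  by apply: red_inv hd2; reduce_terms.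
by apply: red_oppp; split; reduce_terms.
Qed.

End PartialMorphism.

(** * Specializing zeta to a root of a cyclotomic polynomial *)

Section IntegralPart.
Variables (K L : fieldType) (zeta : K) (z : L).

Definition zeval (A : comNzRingType) (x : A) (g : {poly int}) : A :=
  (map_poly intr g).[x].

(* [zeta] specializes to [z], and denominators prime to the characteristic of L
   are allowed. *)
Definition specialize (x : K) (c : L) : Prop := exists n g,
  [/\ n%:R != 0 :> L, n%:R * x = zeval zeta g & n%:R * c = zeval z g].

Lemma zevalD (A : comNzRingType) (x : A) g h :
  zeval x (g + h) = zeval x g + zeval x h.
Proof. by rewrite /zeval rmorphD hornerD. Qed.
Lemma zevalN (A : comNzRingType) (x : A) g : zeval x (- g) = - zeval x g.
Proof. by rewrite /zeval rmorphN hornerN. Qed.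
Lemma zevalM (A : comNzRingType) (x : A) g h :
  zeval x (g * h) = zeval x g * zeval x h.
Proof. by rewrite /zeval rmorphM hornerM. Qed.
Lemma zevalMn (A : comNzRingType) (x : A) g n : zeval x (g *+ n) = zeval x g *+ n.
Proof. by rewrite /zeval rmorphMn hornerMn. Qed.
Lemma zeval1 (A : comNzRingType) (x : A) : zeval x 1 = 1.
Proof. by rewrite /zeval rmorph1 hornerC. Qed.
Lemma zevalX (A : comNzRingType) (x : A) g n :
  zeval x (g \Po 'X^n) = zeval (x ^+ n) g.
Proof. by rewrite /zeval map_comp_poly map_polyXn horner_comp hornerXn. Qed.

Hypothesis hz : forall g, zeval zeta g = 0 -> zeval z g = 0.

Lemma specialize_partial_morphism : partial_morphism specialize.
Proof.
split.
- by exists 1%N, 1; rewrite !zeval1 !mulr1; split; rewrite ?oner_eq0.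
- move=> x y c d [n [g [n0 gx gc]]] [m [h [m0 hx hc]]].
  exists (n * m)%N, (g *+ m + h *+ n); split.
  + by rewrite natrM mulf_neq0.
  + by rewrite zevalD !zevalMn -gx -hx; ring.
  + by rewrite zevalD !zevalMn -gc -hc; ring.
- move=> x c [n [g [n0 gx gc]]]; exists n, (- g).
  by rewrite !zevalN -gx -gc !mulrN.
- move=> x y c d [n [g [n0 gx gc]]] [m [h [m0 hx hc]]].
  exists (n * m)%N, (g * h); split.
  + by rewrite natrM mulf_neq0.
  + by rewrite zevalM -gx -hx; ring.
  + by rewrite zevalM -gc -hc; ring.
move=> c [n [g [n0 gx gc]]]; apply: (mulfI n0); rewrite mulr0 gc.
by apply: hz; rewrite -gx mulr0.
Qed.

(** Writing n x = g(zeta), invariance gives g(zeta^p) = g(zeta), which specializes to g(z^p) = g(z).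
    In characteristic p the left side is g(z)^p, and n is its own p-th power. *)
Lemma specialize_fixed (sigma : {rmorphism K -> K}) p x c :
  p \in [pchar L] -> sigma zeta = zeta ^+ p -> specialize x c -> sigma x = x ->
  c ^+ p = c.
Proof.
move=> pL sz [n [g [n0 gx gc]]] sx.
have sg : zeval zeta (g \Po 'X^p - g) = 0.
  rewrite zevalD zevalN zevalX -sz; apply/eqP; rewrite subr_eq0; apply/eqP.
  transitivity (sigma (zeval zeta g)); last by rewrite -gx rmorphM rmorph_nat sx.
  rewrite /zeval -horner_map -map_poly_comp; congr (_.[_]).
  by apply: eq_map_poly => k /=; rewrite rmorph_int.
have /eqP := hz sg; rewrite zevalD zevalN zevalX subr_eq0 -gc => /eqP E.
have F : zeval (z ^+ p) g = zeval z g ^+ p.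
  rewrite -!(pFrobenius_autE pL) /zeval -horner_map -map_poly_comp.
  congr (_.[_]); apply: eq_map_poly => k /=.
  by rewrite rmorph_int.
apply: (mulfI n0); rewrite -E F -gc exprMn; congr (_ * _).
by rewrite -(pFrobenius_autE pL) rmorph_nat.
Qed.

End IntegralPart.

Definition Fpbar (p : nat) : closedFieldType :=
  projT1 (countable_algebraic_closure 'F_p).

Definition Fp_inj (p : nat) : {rmorphism 'F_p -> Fpbar p} :=
  sval (projT2 (countable_algebraic_closure 'F_p)).

Lemma pchar_Fpbar p : prime p -> p \in [pchar Fpbar p].
Proof. by move=> /pchar_Fp/(rmorph_pchar (Fp_inj p)). Qed.

Lemma Fpbar_frobenius p (c : Fpbar p) : prime p -> c ^+ p = c ->
  exists x, c = Fp_inj p x.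
Proof.
move=> pp hc.
have := congr1 (map_poly (Fp_inj p)) (finField_genPoly 'F_p).
rewrite card_Fp // rmorphB rmorph_prod /= map_polyXn map_polyX => E.
have /eqP : ('X^p - 'X : {poly Fpbar p}).[c] = 0.
  by rewrite hornerD hornerN hornerXn hornerX hc subrr.
rewrite /= in E; rewrite E horner_prod => /prodf_eq0[x _].
by rewrite map_polyXsubC hornerXsubC subr_eq0 => /eqP ->; exists x.
Qed.

Lemma ex_cyclotomic_root f (K : closedFieldType) : (0 < f)%N ->
  exists z : K, zeval z 'Phi_f = 0.
Proof.
move=> f0; suff /closed_rootP[z /rootP rz] :
  size (map_poly (intr : int -> K) 'Phi_f) != 1 by exists z.
rewrite size_map_poly_id0; last first.
  by rewrite (monicP (Cyclotomic_monic f)) rmorph1 oner_eq0.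
by rewrite size_Cyclotomic eqSS -lt0n totient_gt0.
Qed.

(** ['Phi_f] is the minimal polynomial of zeta and monic, so divisibility over Q descends to Z.
    Integral relations of zeta therefore hold at every root of ['Phi_f] in characteristic p. *)
Lemma cyclotomic_dvd f (zeta : algC) (g : {poly int}) :
  f.-primitive_root zeta -> zeval zeta g = 0 -> exists h, g = 'Phi_f * h.
Proof.
move=> pz g0; have [q [Eq _] hq] := minCpolyP zeta.
have Eq' : q = map_poly intr 'Phi_f.
  have ratr_inj : injective (map_poly (ratr : rat -> algC)).
    exact: map_inj_poly (fmorph_inj _) (rmorph0 _).
  apply: ratr_inj; rewrite -Eq (minCpoly_cyclotomic pz) -(Cintr_Cyclotomic pz).
  by rewrite -map_poly_comp; apply: eq_map_poly => k /=; rewrite rmorph_int.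
have : 'Phi_f %| g.
  rewrite -dvdp_rat_int -Eq' -hq /root -map_poly_comp; apply/eqP.
  by rewrite -[RHS]g0; congr (_.[_]); apply: eq_map_poly => k /=; rewrite rmorph_int.
by move=> /dvdpP_int[h]; rewrite zprimitive_monic ?Cyclotomic_monic //; exists h.
Qed.

Lemma rat_rmorph_unique (K : fieldType) (g h : {rmorphism rat -> K}) : g =1 h.
Proof.
by move=> x; rewrite -(divq_num_den x) !fmorph_div !rmorph_int.
Qed.

Lemma common_denominator (L : fieldExtType rat) (zeta x : L) :
  x \in <<1; zeta>>%VS ->
  exists n g, (0 < n)%N /\ n%:R * x = zeval zeta g.
Proof.
move=> /Fadjoin_polyP[p /polyOver1P[q ->] ->].
have [r [m m0 Er]] := rat_poly_scale q.
have H : m%:~R * (map_poly (in_alg L) q).[zeta] = zeval zeta r.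
  rewrite Er map_polyZ hornerZ fmorphV rmorph_int mulrA mulfV.
    rewrite mul1r /zeval -map_poly_comp; congr (_.[_]).
    by apply: eq_map_poly => k; rewrite -(rmorph_int (in_alg L)).
  by rewrite -(rmorph_int (in_alg L)) fmorph_eq0 intr_eq0.
(* The integer denominator may be negative; its sign is moved into the polynomial. *)
case: m m0 H {Er} => m m0 H.
  by exists m, r; rewrite lt0n; split.
exists m.+1, (- r); split => //; rewrite zevalN -H NegzE.
by rewrite rmorphN mulNr opprK.
Qed.

(** * Properties valid at all large primes *)

Definition eventually (A : nat -> Prop) :=
  exists N, forall p, prime p -> (N < p)%N -> A p.

Lemma eventually_and A B : eventually A -> eventually B ->
  eventually (fun p => A p /\ B p).
Proof.
move=> [N hN] [M hM]; exists (maxn N M) => p pp; rewrite gtn_max => /andP[Np Mp].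
by split; [apply: hN | apply: hM].
Qed.

Lemma eventually_all (T : eqType) (s : seq T) (A : T -> nat -> Prop) :
  (forall x, x \in s -> eventually (A x)) ->
  eventually (fun p => forall x, x \in s -> A x p).
Proof.
elim: s => [|x s IH] h; first by exists 0%N.
have [N hN] := eventually_and (h x (mem_head x s))
  (IH (fun y ys => h y (mem_behead (ys : y \in behead (x :: s))))).
exists N => p pp Np y; rewrite inE => /orP[/eqP ->|]; first by have [] := hN p pp Np.
by have [_] := hN p pp Np; apply.
Qed.

Lemma eventually_sub (A B : nat -> Prop) :
  (forall p, prime p -> A p -> B p) -> eventually A -> eventually B.
Proof. by move=> AB [N hN]; exists N => p pp Np; apply: AB => //; apply: hN. Qed.

Section EventualReduction.
Variables (K : fieldType) (L : nat -> fieldType).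
Variable Red : forall p, K -> L p -> Prop.
Hypothesis pm : forall p, prime p -> partial_morphism (@Red p).
Hypothesis dom : forall x, eventually (fun p => exists c, @Red p x c).

(** The n additions are carried out over K, so their denominators form a finite set independent of
    p. *)
Lemma eventually_mulpn (W : weierstrass K) P n : eventually (fun p =>
  forall W' P', red_curve (@Red p) W W' -> red_point (@Red p) P P' ->
    red_point (@Red p) (mulpn W n P) (mulpn W' n P')).
Proof.
elim: n => [|n IH]; first by exists 0%N.
have D := eventually_all (fun x (_ : x \in denominators W P (mulpn W n P)) => dom x).
apply: eventually_sub (eventually_and IH D) => p pp [H hD] W' P' hW hP.
exact: (red_addp (pm pp) hW hP (H _ _ hW hP) hD).
Qed.

Lemma eventually_dom_point P :
  eventually (fun p => exists P', red_point (@Red p) P P').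
Proof.
case: P => [[x y]|]; last by exists 0%N => p _ _; exists None.
apply: eventually_sub (eventually_and (dom x) (dom y)).
by move=> p _ [[c hc] [d hd]]; exists (Some (c, d)).
Qed.

Lemma eventually_neq_point P Q : P != Q -> eventually (fun p =>
  forall P', red_point (@Red p) P P' -> red_point (@Red p) Q P' -> False).
Proof.
case: P Q => [[x y]|] [[x' y']|] //; try by move=> _; exists 0%N => p _ _ [[]|].
move=> N; apply: eventually_sub (eventually_and (dom (x - x')^-1) (dom (y - y')^-1)).
move=> p pp [[c hc] [d hd]] [[u v]|] // [hx hy] [hx' hy'].
have := red_eq (pm pp) hx hx' hc; have := red_eq (pm pp) hy hy' hd.
rewrite !eqxx => Ey Ex; case/eqP: N.
by rewrite (eqP (esym Ex)) (eqP (esym Ey)).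
Qed.

Lemma eventually_torsion (W : weierstrass K) n (s : seq (option (K * K))) :
  uniq s -> (forall P, P \in s -> torsion_points W n P) ->
  eventually (fun p => forall W' : weierstrass (L p), red_curve (@Red p) W W' ->
    [/\ forall P, P \in s -> exists P', red_point (@Red p) P P',
        forall P P', P \in s -> red_point (@Red p) P P' ->
          torsion_points W' n P' &
        forall P Q P', P \in s -> Q \in s -> red_point (@Red p) P P' ->
          red_point (@Red p) Q P' -> P = Q]).
Proof.
move=> us hs.
have D1 := eventually_all (fun P (_ : P \in s) => eventually_dom_point P).
have D2 := eventually_all (fun P (_ : P \in s) => eventually_mulpn W P n).
have D3 : eventually (fun p => forall PQ,
    PQ \in [seq PQ <- [seq (P, Q) | P <- s, Q <- s] | PQ.1 != PQ.2] ->
    forall P', red_point (@Red p) PQ.1 P' -> red_point (@Red p) PQ.2 P' -> False).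
  apply: eventually_all => -[P Q]; rewrite mem_filter => /andP[N _].
  exact: eventually_neq_point.
apply: eventually_sub (eventually_and (eventually_and D1 D2) D3).
move=> p pp [[h1 h2] h3] W' hW; split => //.
  move=> P P' Ps hP; have [CP TP] := hs P Ps; split.
    exact: (red_rational (pm pp) hW hP CP).
  by have := h2 P Ps W' P' hW hP; rewrite TP; case: (mulpn W' n P').
move=> P Q P' Ps Qs hP hQ; apply/eqP/negPn/negP => N.
apply: (h3 (P, Q) _ P' hP hQ); rewrite mem_filter N /=.
by apply/allpairsP; exists (P, Q).
Qed.

End EventualReduction.

(** * Descent to Q(zeta) and conclusion *)

Lemma mulpn_dvd (F : fieldType) (W : weierstrass F) q d P : (q %| d)%N ->
  torsion_points W q P -> torsion_points W d P.
Proof.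
move=> /dvdnP[k ->] [CP TP]; split => //; elim: k => [//|k IH].
by rewrite mulSn /mulpn iterD -/(mulpn W (k * q) P) IH.
Qed.

Lemma prime_divisor_235 d : d \in [:: 2; 3; 4; 5; 6; 8]%N ->
  exists2 q, q \in [:: 2; 3; 5]%N & (q %| d)%N.
Proof.
by rewrite !inE => /or4P[/eqP ->|/eqP ->|/eqP ->|/or3P[] /eqP ->];
  [exists 2%N | exists 3%N | exists 2%N | exists 5%N | exists 2%N | exists 2%N].
Qed.

Lemma map_weierstrass_disc (R S : comNzRingType) (h : {rmorphism R -> S}) W :
  disc (map_weierstrass h W) = h (disc W).
Proof.
by rewrite /disc /b8 /b6 /b4 /b2 /=; ring.
Qed.

Lemma prim_expz_modn (K : fieldType) (f p : nat) (a : int) (zeta : K) :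
  f.-primitive_root zeta -> (p%:Z = a %[mod f%:Z])%Z -> zeta ^ a = zeta ^+ p.
Proof.
move=> pz E; have f0 := prim_order_gt0 pz.
have z0 : zeta != 0.
  apply: contra_eq_neq (prim_expr_order pz) => ->.
  by rewrite expr0n -[f]prednK // eq_sym oner_eq0.
have red (n : int) : zeta ^ n = zeta ^ (n %% f)%Z.
  rewrite {1}(divz_eq n f) [(_ * f%:Z)%R]mulrC expfzDr // -exprz_exp.
  by rewrite -[zeta ^ f%:Z]/(zeta ^+ f) (prim_expr_order pz) exp1rz mul1r.
by rewrite red -E -red.
Qed.

Lemma torsion_in_division_field (E : weierstrass rat) d (x y : algC) :
  torsion_points (map_weierstrass ratr E) d (Some (x, y)) ->
  division_field E d x /\ division_field E d y.
Proof.
by move=> T; split; apply: sub_gen_smallest; exists x, y; split => //; [left|right].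
Qed.

Lemma map_change_of_variables (K L : fieldType) (h : {rmorphism K -> L})
    (W : weierstrass K) (u r s t : K) :
  map_weierstrass h (change_of_variables W u r s t) =
  change_of_variables (map_weierstrass h W) (h u) (h r) (h s) (h t).
Proof.
by congr Weierstrass; rewrite /= fmorph_div ?rmorphXn; congr (_ / _); ring.
Qed.

Theorem proposition1
  (E : weierstrass rat) (hE : elliptic E)
  (W : weierstrass int) (hW : global_minimal_model E W)
  (f : nat) (hf : (1 <= f)%N)
  (a : int) (haf : coprimez a f%:Z)
  (Qf : splittingFieldType rat) (zeta : Qf)
  (hzeta : f.-primitive_root zeta) (hQf : <<1; zeta>>%VS = fullv)
  (iota : {rmorphism Qf -> algC})
  (sigma_a : gal_of {:Qf}) (hsigma : sigma_a \in ('Gal({:Qf} / 1))%g)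
  (hsigma_a : sigma_a zeta = zeta ^ a)
  (d : nat) (hd : d \in [:: 2; 3; 4; 5; 6; 8]%N)
  (hK : division_field E d `<=` range iota)
  (hfix : forall x : Qf, division_field E d (iota x) -> sigma_a x = x) :
  finite_set [set p : nat | [/\ prime p, good_reduction W p,
                               (p%:Z = a %[mod f%:Z])%Z &
                               cyclic_points (reduction W p)]].
Proof.
have [q hq qd] := prime_divisor_235 hd.
pose EQ := map_weierstrass (in_alg Qf) E.
have hEQ : elliptic EQ by rewrite /elliptic map_weierstrass_disc fmorph_eq0.
have EC : map_weierstrass iota EQ = map_weierstrass ratr E.
  by congr Weierstrass; apply: (rat_rmorph_unique (iota \o in_alg Qf) ratr).
have hEC : elliptic (map_weierstrass (ratr : rat -> algC) E).
  by rewrite /elliptic -EC map_weierstrass_disc fmorph_eq0.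
have [sg sgE] : exists sg : {rmorphism Qf -> Qf}, sg =1 sigma_a.
  by exists (sigma_a : {rmorphism Qf -> Qf}).
pose fixed (P : option (Qf * Qf)) :=
  if P is Some (x, y) then sg x = x /\ sg y = y else True.
(* The q + 1 points found over [algC] are d-torsion, so [hK] pulls their coordinates back along
   [iota] and [hfix] makes them invariant. *)
have [l [ul sl hl]] : exists l : seq (option (Qf * Qf)), [/\ uniq l, size l = q.+1 &
    forall P, P \in l -> fixed P /\ torsion_points EQ q P].
  have [l [ul sl hl]] := weierstrass_torsion hEC hq.
  have /choice[phi hphi] P : exists P', P \in l ->
      map_point iota P' = P /\ fixed P'.
    have [/hl TP|/negP nPl] := boolP (P \in l); last by exists None.
    case: P TP => [[x y]|] TP; last by exists None.
    have [Dx Dy] := torsion_in_division_field (mulpn_dvd qd TP).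
    have [[x' _ Ex] [y' _ Ey]] := (hK _ Dx, hK _ Dy).
    exists (Some (x', y')) => _; split; first by rewrite /= Ex Ey.
    by split; rewrite sgE; apply: hfix; rewrite ?Ex ?Ey.
  exists (map phi l); split.
  - rewrite map_inj_in_uniq // => P Q Pl Ql Epq.
    by have [<- _] := hphi P Pl; have [<- _] := hphi Q Ql; rewrite Epq.
  - by rewrite size_map.
  move=> _ /mapP[P Pl ->]; have [EP FP] := hphi P Pl; split => //.
  by apply/(map_torsion iota EQ q); rewrite EC EP; apply: hl.
(* The points move to the minimal model; u, r, s and t are rational, so invariance under sigma_a is
   kept. *)
have [[u [r [s [t [u0 EW]]]]] _] := hW.
pose WQ := map_weierstrass (intr : int -> Qf) W.
have u0' : in_alg Qf u != 0 by rewrite fmorph_eq0.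
pose cov := cov_point (in_alg Qf u) (in_alg Qf r) (in_alg Qf s) (in_alg Qf t).
have EWQ : WQ = change_of_variables EQ (in_alg Qf u) (in_alg Qf r) (in_alg Qf s)
    (in_alg Qf t).
  have -> : WQ = map_weierstrass (in_alg Qf)
      (map_weierstrass (fun n : int => n%:~R : rat) W).
    by congr Weierstrass; rewrite -(rmorph_int (in_alg Qf)).
  by rewrite EW map_change_of_variables.
pose l' := map cov l.
have ul' : uniq l' by rewrite map_inj_uniq //; exact: can_inj (cov_pointK _ _ _ u0').
have hl' P : P \in l' -> fixed P /\ torsion_points WQ q P.
  move=> /mapP[Q Ql ->]; have [FQ TQ] := hl Q Ql.
  split; last by rewrite EWQ; apply/cov_torsion.
  case: Q FQ {Ql TQ} => [[x y]|] //= [Fx Fy].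
  have Fc c : sg (in_alg Qf c) = in_alg Qf c.
    exact: (rat_rmorph_unique (sg \o in_alg Qf) (in_alg Qf)).
  split.
    by rewrite fmorph_div rmorphXn rmorphB Fx !Fc.
  by rewrite fmorph_div rmorphXn !rmorphB rmorphM rmorphB Fx Fy !Fc.
pose z p := projT1 (cid (ex_cyclotomic_root (Fpbar p) hf)).
have hz p g : zeval zeta g = 0 -> zeval (z p) g = 0.
  move=> g0; have [||h ->] := @cyclotomic_dvd f (iota zeta) g.
  - by rewrite fmorph_primitive_root.
  - rewrite -[RHS](rmorph0 iota) -g0 /zeval -horner_map -map_poly_comp.
    by congr (_.[_]); apply: eq_map_poly => k /=; rewrite rmorph_int.
  by rewrite zevalM (projT2 (cid (ex_cyclotomic_root (Fpbar p) hf))) mul0r.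
pose Red p := @specialize Qf (Fpbar p) zeta (z p).
have pm p : prime p -> partial_morphism (Red p).
  by move=> _; apply: specialize_partial_morphism; apply: hz.
have dom x : eventually (fun p => exists c, Red p x c).
  have [|n [g [n0 gx]]] := @common_denominator Qf zeta x.
    by rewrite hQf memvf.
  (* A prime above the common denominator n cannot divide it. *)
  exists n => p pp np; exists (zeval (z p) g / n%:R), n, g.
  have nz : n%:R != 0 :> Fpbar p.
    by rewrite -(dvdn_pcharf (pchar_Fpbar pp)) gtnNdvd.
  by split => //; rewrite mulrC divfK.
have [N hN] := eventually_torsion pm dom ul' (fun P Pl => (hl' P Pl).2).
apply: (@sub_finite_set _ _ `I_N.+1); last exact: finite_II.
move=> p [pp gp pa cp]; rewrite /= ltnS leqNgt; apply/negP => Np.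
pose Wp := map_weierstrass (Fp_inj p) (reduction W p).
have hWp : red_curve (Red p) WQ Wp.
  have H n : Red p n%:~R (Fp_inj p n%:~R).
    exists 1%N, n%:P; split; rewrite ?oner_eq0 // mul1r /zeval map_polyC hornerC //.
    by rewrite rmorph_int.
  by split; apply: H.
have [h1 h2 h3] := hN p pp Np Wp hWp.
have sp : sg zeta = zeta ^+ p by rewrite sgE hsigma_a (prim_expz_modn hzeta pa).
have frob x c : sg x = x -> Red p x c -> exists c', c = Fp_inj p c'.
  move=> sx xc; apply: Fpbar_frobenius => //.
  exact: (specialize_fixed (hz p) (sigma := sg) (pchar_Fpbar pp) sp xc sx).
have /choice[phi hphi] P : exists P', P \in l' ->
    red_point (Red p) P (map_point (Fp_inj p) P').
  have [Pl|/negP nPl] := boolP (P \in l'); last by exists None.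
  have [[FP _] [P' hP]] := (hl' P Pl, h1 P Pl).
  case: P P' FP hP {Pl} => [[x y]|] [[x' y']|] //.
    move=> [Fx Fy] [hx hy]; have [[c Ec] [e Ee]] := (frob _ _ Fx hx, frob _ _ Fy hy).
    by exists (Some (c, e)) => _; rewrite /= -Ec -Ee.
  by exists None.
have hWr : elliptic (reduction W p).
  by rewrite /elliptic map_weierstrass_disc /= -(dvdz_pcharf (pchar_Fp pp)).
(* The q + 1 points reduce to distinct q-torsion points over F_p, whereas cyclicity allows at most
   q. *)
have := @cyclic_points_torsion _ _ q (map phi l') hWr cp.
rewrite size_map size_map sl ltnn => H; suff: false by []; apply: H.
- by move: hq; rewrite !inE => /or3P[] /eqP ->.
- rewrite map_inj_in_uniq // => P Q Pl Ql Epq.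
  by apply: (h3 P Q _ Pl Ql (hphi P Pl)); rewrite Epq; apply: hphi.
move=> _ /mapP[P Pl ->].
by apply/(map_torsion (Fp_inj p)); apply: h2 (hphi P Pl).
Qed.
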